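(* Let $(M,J,g)$ be a compact almost Hermitian manifold of real dimension $2n$ with Kähler form $\omega$, let $\Omega\subseteq M$ be a smooth pseudoconvex domain, and let $\rho$ be a smooth strictly $J$-plurisubharmonic defining function for $\Omega$. Let $\varphi,h\in C^\infty(\bar\Omega)$. Then there exists a strictly $J$-plurisubharmonic subsolution $\underline{u}\in C^2(\bar\Omega)$ of the Dirichlet problem for the Monge-Ampère equation, that is, $$(\sqrt{-1}\partial\bar\partial\underline{u})^{n}\ge e^{h}\omega^{n}\ \text{ in }\Omega,\qquad \underline{u}=\varphi\ \text{ on }\partial\Omega .$$ More precisely, if $\hat\varphi\in C^2(\bar\Omega)$ is any $J$-plurisubharmonic extension of $\varphi|_{\partial\Omega}$, then for all sufficiently large $s>0$ one may take $\underline{u}=\hat\varphi+s(e^{\rho}-1)$.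
   Context: An almost Hermitian manifold $(M,J,g)$ is a manifold with an almost complex structure $J$ (not necessarily integrable) and a Riemannian metric $g$ with $g(JX,JY)=g(X,Y)$; its Kähler form is $\omega(X,Y)=g(JX,Y)$. Let $T_{1,0}M$ and $T_{0,1}M$ be the $\sqrt{-1}$- and $-\sqrt{-1}$-eigenbundles of $J$ on $TM\otimes_{\mathbb R}\mathbb C$. On $(p,q)$-forms, $\partial$ and $\bar\partial$ are the components of the exterior derivative $d$ of type $(p+1,q)$ and $(p,q+1)$. For a real $C^2$ function $v$ and a local $g$-unitary frame $e_1,\dots,e_n$ of $T_{1,0}M$ with dual frame $\theta_1,\dots,\theta_n$, $\sqrt{-1}\partial\bar\partial v=\sqrt{-1}\sum_{i,j}v_{i\bar j}\,\theta_i\wedge\bar\theta_j$ with $v_{i\bar j}=e_i\bar e_jv-[e_i,\bar e_j]^{(0,1)}v$, where $(\cdot)^{(0,1)}$ is the projection to $T_{0,1}M$. A $C^2$ real function $v$ is $J$-plurisubharmonic ($J$-psh) on $\Omega$ if the Hermitian matrix $(v_{i\bar j})$ is nonnegative at each point of $\Omega$. A function $v\in C^2(\bar\Omega)$ is strictly $J$-psh if for each $\psi\in C^2(\bar\Omega)$ there is $\varepsilon_0>0$ such that $v+\varepsilon\psi$ is $J$-psh on $\Omega$ for all $0<\varepsilon<\varepsilon_0$; equivalently, $\sqrt{-1}\partial\bar\partial v\ge\tau\omega$ on $\Omega$ for some constant $\tau>0$. A defining function for $\Omega$ is a smooth function $\rho$ on a neighbourhood of $\bar\Omega$ with $\rho<0$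 in $\Omega$, $\rho=0$ and $d\rho\ne0$ on $\partial\Omega$. *)

(* Defs.v *)
From HB Require Import structures.
From mathcomp Require Import all_boot all_order all_algebra all_fingroup.
From mathcomp Require Import all_classical all_reals all_analysis.
From mathcomp Require Import complex.

Set Implicit Arguments.
Unset Strict Implicit.
Unset Printing Implicit Defensive.

Import Order.TTheory GRing.Theory Num.Theory.
Import numFieldNormedType.Exports.

Local Open Scope classical_set_scope.
Local Open Scope ring_scope.
Local Open Scope sesquilinear_scope.

(** * C^r functions on open subsets of R^m *)

Section Regularity.
Context {R : realType} {m : nat}.

(* [U] is meant to be open. *)
Fixpoint Ck (k : nat) (U : set 'rV[R]_m) (f : 'rV[R]_m -> R) : Prop :=
  if k is k'.+1 then
    (forall x, U x -> differentiable f x) /\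
    (forall a : 'I_m, Ck k' U ('D_(delta_mx 0 a) f))
  else forall x, U x -> {for x, continuous f}.

(* [Some k] is C^k, [None] is C^infinity. *)
Definition Cr (r : option nat) (U : set 'rV[R]_m) (f : 'rV[R]_m -> R) : Prop :=
  if r is Some k then Ck k U f else forall k, Ck k U f.

End Regularity.

Notation C2 := (Some 2%N).
Notation Cinfty := (@None nat).

(** * Smooth manifolds and functions on them *)

(* The coordinate maps and their inverses are total functions whose values are
   only meaningful on [dom i] and on [coord i @` dom i] respectively. *)
Record smooth_manifold (R : realType) (m : nat) (M : topologicalType) :=
  SmoothManifold {
  chart : Type;
  dom : chart -> set M;
  coord : chart -> M -> 'rV[R]_m;
  par : chart -> 'rV[R]_m -> M;
  mfd_hausdorff : hausdorff_space M;
  mfd_second_countable : @second_countable M;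
  dom_open : forall i, open (dom i);
  dom_cover : forall p, exists i, dom i p;
  img_open : forall i, open (coord i @` dom i);
  coordK : forall i p, dom i p -> par i (coord i p) = p;
  coord_continuous : forall i p, dom i p -> {for p, continuous (coord i)};
  par_continuous :
    forall i x, (coord i @` dom i) x -> {for x, continuous (par i)};
  transition_smooth : forall i j (b : 'I_m),
    Cr Cinfty (coord i @` (dom i `&` dom j)) (fun x => coord j (par i x) 0 b)
}.

Section FunctionsOnManifolds.
Context {R : realType} {m : nat} {M : topologicalType}.
Variable X : smooth_manifold R m M.

(* [U] is meant to be open. *)
Definition C_on (r : option nat) (U : set M) (v : M -> R) : Prop :=
  forall i : chart X, Cr r (coord i @` (dom i `&` U)) (v \o par i).

(* C^r(closure Omega): restrictions of C^r functions defined near the closure;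
   the values of [v] off the closure are irrelevant. *)
Definition C_closure (r : option nat) (Omega : set M) (v : M -> R) : Prop :=
  exists (U : set M) (w : M -> R),
    [/\ open U, closure Omega `<=` U, C_on r U w &
        forall p, closure Omega p -> v p = w p].

(* Jacobian matrix at [p] of the change of coordinates from [i] to [j], acting
   on the right of row vectors: [Y] in chart [i] reads [Y *m jac_change i j p]
   in chart [j]. *)
Definition jac_change (i j : chart X) (p : M) : 'M[R]_m :=
  'J (coord j \o par i) (coord i p).

(* The boundary of an open set. *)
Definition bdry (Omega : set M) : set M := closure Omega `\` Omega.

Definition domain (Omega : set M) : Prop :=
  [/\ open Omega, Omega !=set0 & connected Omega].

Definition defining_function (Omega : set M) (rho : M -> R) : Prop :=
  [/\ exists U, [/\ open U, closure Omega `<=` U & C_on Cinfty U rho],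
      forall p, Omega p -> rho p < 0,
      forall p, bdry Omega p -> rho p = 0 &
      forall p, bdry Omega p -> forall i : chart X, dom i p ->
        exists a : 'I_m, 'D_(delta_mx 0 a) (rho \o par i) (coord i p) != 0].

End FunctionsOnManifolds.

(** * Almost Hermitian structures *)

(* Tensor fields are given by their components in each chart, as functions of
   the coordinates. Tangent vectors are row vectors of components: [J Y] is
   [Y *m acs i x] and [g(Y, Z)] is [Y *m metric i x *m Z^T]. *)
Record almost_hermitian (R : realType) (n : nat) (M : topologicalType)
    (X : smooth_manifold R (n + n) M) := AlmostHermitian {
  acs : chart X -> 'rV[R]_(n + n) -> 'M[R]_(n + n);
  metric : chart X -> 'rV[R]_(n + n) -> 'M[R]_(n + n);
  acs_smooth : forall i a b,
    Cr Cinfty (coord i @` dom i) (fun x => acs i x a b);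
  acs_change : forall (i j : chart X) p, dom i p -> dom j p ->
    acs i (coord i p) *m jac_change i j p =
    jac_change i j p *m acs j (coord j p);
  acs_square : forall (i : chart X) p, dom i p ->
    acs i (coord i p) *m acs i (coord i p) = - 1%:M;
  metric_smooth : forall i a b,
    Cr Cinfty (coord i @` dom i) (fun x => metric i x a b);
  metric_change : forall (i j : chart X) p, dom i p -> dom j p ->
    metric i (coord i p) =
    jac_change i j p *m metric j (coord j p) *m (jac_change i j p)^T;
  metric_sym : forall (i : chart X) p, dom i p ->
    (metric i (coord i p))^T = metric i (coord i p);
  metric_pos : forall (i : chart X) p, dom i p ->
    forall Y : 'rV[R]_(n + n), Y != 0 ->
    0 < (Y *m metric i (coord i p) *m Y^T) 0 0;
  metric_acs : forall (i : chart X) p, dom i p ->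
    acs i (coord i p) *m metric i (coord i p) *m (acs i (coord i p))^T =
    metric i (coord i p)
}.

(** * Complex forms and the operators d, del, delbar in coordinates *)

Section ComplexForms.
Context {R : realType} {n : nat}.
Let V := 'rV[R]_(n + n).
Implicit Types (J : V -> 'M[R]_(n + n)) (x : V).

Definition complexify (p q : nat) (A : 'M[R]_(p, q)) : 'M[R[i]]_(p, q) :=
  map_mx (real_complex R) A.

Definition dpartial (a : 'I_(n + n)) (f : V -> R[i]) x : R[i] :=
  Complex ('D_(delta_mx 0 a) (fun y => complex.Re (f y)) x)
          ('D_(delta_mx 0 a) (fun y => complex.Im (f y)) x).

(* A 1-form is the column of its values on the coordinate vectors D_a. A 2-form
   is the matrix of its values on the pairs (D_a, D_b), so that its value on
   (Y, Z) is [Y *m A *m Z^T]. *)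
Definition d0 (f : V -> R[i]) x : 'cV[R[i]]_(n + n) :=
  \col_a dpartial a f x.

(* d(beta)(Y, Z) = Y(beta Z) - Z(beta Y) - beta [Y, Z], with no factor 1/2. *)
Definition d1 (beta : V -> 'cV[R[i]]_(n + n)) x : 'M[R[i]]_(n + n) :=
  \matrix_(a, b)
    (dpartial a (fun y => beta y b 0) x - dpartial b (fun y => beta y a 0) x).

(* Projections of complex tangent vectors onto T_{1,0} and T_{0,1}, acting on
   the right. *)
Definition proj10 (J : 'M[R]_(n + n)) : 'M[R[i]]_(n + n) :=
  2^-1 *: (1%:M - 'i%C *: complexify J).
Definition proj01 (J : 'M[R]_(n + n)) : 'M[R[i]]_(n + n) :=
  2^-1 *: (1%:M + 'i%C *: complexify J).

(* Type components: beta^{0,1}(Y) = beta(Y^{0,1}), and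
   alpha^{1,1}(Y, Z) = alpha(Y^{1,0}, Z^{0,1}) + alpha(Y^{0,1}, Z^{1,0}). *)
Definition part01 (J : 'M[R]_(n + n)) (beta : 'cV[R[i]]_(n + n)) :
    'cV[R[i]]_(n + n) :=
  proj01 J *m beta.
Definition part11 (J : 'M[R]_(n + n)) (alpha : 'M[R[i]]_(n + n)) :
    'M[R[i]]_(n + n) :=
  proj10 J *m alpha *m (proj01 J)^T + proj01 J *m alpha *m (proj10 J)^T.

(* delbar on functions and del on (0,1)-forms. *)
Definition delbar J (f : V -> R[i]) x : 'cV[R[i]]_(n + n) :=
  part01 (J x) (d0 f x).
Definition del01 J (beta : V -> 'cV[R[i]]_(n + n)) x : 'M[R[i]]_(n + n) :=
  part11 (J x) (d1 beta x).

Definition ddbar J (v : V -> R) : V -> 'M[R[i]]_(n + n) :=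
  del01 J (delbar J (fun y => real_complex R (v y))).

(* The value of the n-th exterior power of a 2-form on the ordered basis
   (D_1, D_{n+1}, D_2, D_{n+2}, ..., D_n, D_{2n}), from
   alpha^n(Y_1, ..., Y_2n) =
     2^-n \sum_s sgn(s) \prod_k alpha(Y_{s(2k-1)}, Y_{s(2k)}).
   It determines the top-degree form alpha^n. *)
Definition wedge_power (alpha : 'M[R[i]]_(n + n)) : R[i] :=
  2^-1 ^+ n * \sum_(s : 'S_(n + n))
    (-1) ^+ s * \prod_(k < n) alpha (s (lshift n k)) (s (rshift n k)).

(* In the order of R[i], [0 <= z] says that z is real and nonnegative, so a
   matrix with this property is Hermitian. *)
Definition nonneg_hermitian (k : nat) (A : 'M[R[i]]_k) : Prop :=
  forall z : 'rV[R[i]]_k, 0 <= (z *m A *m z ^t*) 0 0.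

End ComplexForms.

(** * J-plurisubharmonic functions and the Monge-Ampere equation *)

Section Psh.
Context {R : realType} {n : nat} {M : topologicalType}.
Context {X : smooth_manifold R (n + n) M}.
Variable H : almost_hermitian X.
Implicit Types (i : chart X) (p : M) (Omega : set M) (v : M -> R).

Definition acs_at i p : 'M[R]_(n + n) := acs H i (coord i p).
Definition metric_at i p : 'M[R]_(n + n) := metric H i (coord i p).

Definition ddbar_at i v p : 'M[R[i]]_(n + n) :=
  ddbar (acs H i) (v \o par i) (coord i p).

(* omega(Y, Z) = g(J Y, Z) *)
Definition kahler_at i p : 'M[R[i]]_(n + n) :=
  complexify (acs_at i p *m metric_at i p).

Definition T10_at i p (k : nat) (E : 'M[R[i]]_(k, n + n)) : Prop :=
  E *m complexify (acs_at i p) = 'i%C *: E.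

(* The rows e_1, ..., e_n of [E] are a unitary basis of T_{1,0} at [p]:
   g(e_i, conj e_j) = delta_ij. *)
Definition unitary_frame_at i p (E : 'M[R[i]]_(n, n + n)) : Prop :=
  T10_at i p E /\ E *m complexify (metric_at i p) *m E ^t* = 1%:M.

(* The coefficients v_{i jbar} = (del delbar v)(e_i, conj e_j) of
   del delbar v = \sum v_{i jbar} theta_i /\ conj theta_j. When the e_i extend to
   local sections of T_{1,0}, the formula for d(delbar v) gives
   v_{i jbar} = e_i (conj e_j v) - [e_i, conj e_j]^{(0,1)} v; these numbers
   depend on the frame at [p] only. *)
Definition complex_hessian i v p (E : 'M[R[i]]_(n, n + n)) : 'M[R[i]]_n :=
  E *m ddbar_at i v p *m E ^t*.

Definition Jpsh Omega v : Prop :=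
  C_on X C2 Omega v /\
  forall p, Omega p -> forall i : chart X, dom i p ->
    forall E, unitary_frame_at i p E ->
      nonneg_hermitian (complex_hessian i v p E).

Definition strictly_Jpsh Omega v : Prop :=
  C_closure X C2 Omega v /\
  forall psi, C_closure X C2 Omega psi ->
    exists2 eps0 : R, 0 < eps0 &
      forall eps, 0 < eps -> eps < eps0 ->
        Jpsh Omega (fun p => v p + eps * psi p).

(* Smoothly bounded, with Levi form nonnegative on the complex tangent spaces
   T_{1,0} /\ ker d(r) of the boundary. *)
Definition smooth_pseudoconvex_domain Omega : Prop :=
  domain Omega /\
  exists2 r : M -> R, defining_function X Omega r &
    forall p, bdry Omega p -> forall i : chart X, dom i p ->
    forall Y : 'rV[R[i]]_(n + n), T10_at i p Y ->
      (Y *m d0 (fun y => real_complex R (r (par i y))) (coord i p)) 0 0 = 0 ->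
      0 <= (Y *m ddbar_at i r p *m Y ^t*) 0 0.

(* (sqrt(-1) del delbar u)^n >= e^h omega^n at every point of Omega: since
   omega^n is a volume form, this says that the left-hand side is a multiple of
   omega^n by a real number at least e^h. *)
Definition MA_ge Omega (h u : M -> R) : Prop :=
  forall p, Omega p -> forall i : chart X, dom i p ->
    exists2 c : R, expR (h p) <= c &
      wedge_power ('i%C *: ddbar_at i u p) =
      real_complex R c * wedge_power (kahler_at i p).

Definition strictly_Jpsh_subsolution Omega (h phi u : M -> R) : Prop :=
  [/\ C_closure X C2 Omega u, strictly_Jpsh Omega u, MA_ge Omega h u &
      forall p, bdry Omega p -> u p = phi p].

End Psh.

(* Main.v *)
From mathcomp Require Import all_boot all_order all_algebra all_fingroup.
From mathcomp Require Import all_classical all_reals all_analysis.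
From mathcomp Require Import complex.
Require Import Defs.

Set Implicit Arguments.
Unset Strict Implicit.
Unset Printing Implicit Defensive.

Import Order.TTheory GRing.Theory Num.Theory.
Import numFieldNormedType.Exports.

Local Open Scope classical_set_scope.
Local Open Scope ring_scope.
Local Open Scope sesquilinear_scope.

(** The candidate is [u = phihat + s (exp rho - 1)], and everything rests on the
    Levi form [L v Y = (del delbar v)(Y, conj Y)] of a (1,0) vector [Y]
    ([levi]). It is linear in [v] and satisfies the chain rule
    [L (G o v) = G'(v) L v + G''(v) |dv(Y)|^2] ([levi_comp]):
    [delbar (G o v) = G'(v) delbar v], and [(dv /\ delbar v)(Y, conj Y)] is
    [|dv(Y)|^2] because [delbar v] vanishes on [Y]. For [G = exp] this gives
    [L u = L phihat + s exp(rho) (L rho + |d rho(Y)|^2)], which is at least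
    [s exp(rho) L rho] ([levi_candidate_ge]).

    Strictness of [u] follows from that of [rho]: a perturbation [e psi] is
    absorbed by [s exp(rho) rho] as soon as [e / (s exp rho)] is admissible for
    [rho], and [exp rho] is bounded below on the compact closure
    ([candidate_spsh]).

    For the Monge-Ampere inequality one needs a constant [t > 0] with
    [L rho Y >= t g(Y, conj Y)] at all points and in all charts
    ([spsh_uniform]). It comes from testing strictness on functions on [M] that
    coincide near a point [p0] with the centred coordinates [F_b] of a fixed
    chart ([C2_extension]). Strictness for [F_b] and [- F_b] makes [|L F_b|] at
    most [L rho / e]; strictness for [- \sum_b F_b ^+ 2], whose Levi form
    expands by the chain rule, then yields [L rho >= e \sum_b |dF_b(Y)|^2]
    near [p0] ([spsh_local_bound]). The numbers [dF_b(Y)] are the components of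
    [Y] in the fixed chart, so the right-hand side dominates the metric, and
    compactness of the closure gives a uniform constant.

    Finally, in a unitary frame [E] the quotient of [(i del delbar u)^n] by
    [omega^n] is the determinant of the complex Hessian ([wedge_power_ratio]).
    The eigenvalues of that Hermitian matrix are at least [K = s m t], where [m]
    is a lower bound for [exp rho]; hence the quotient is at least [K ^+ n]
    ([wedge_power_ge]), which exceeds [exp h] for large [s]. The extension
    [phihat = phi + rho / e] with [e] small is J-plurisubharmonic by strictness
    of [rho], which gives the existence statement. *)

(** * Hermitian forms *)

Section HermitianForms.
Context {C : numClosedFieldType}.

Definition sform n (A : 'M[C]_n) (y z : 'rV[C]_n) : C := (y *m A *m z ^t*) 0 0.

Lemma trmxC_mul m n p (A : 'M[C]_(m, n)) (B : 'M[C]_(n, p)) :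
  (A *m B) ^t* = B ^t* *m A ^t*.
Proof. by rewrite trmx_mul map_mxM. Qed.

Lemma sformDl n (A : 'M[C]_n) y y' z :
  sform A (y + y') z = sform A y z + sform A y' z.
Proof. by rewrite /sform !mulmxDl [LHS]mxE. Qed.

Lemma sformDr n (A : 'M[C]_n) y z z' :
  sform A y (z + z') = sform A y z + sform A y z'.
Proof. by rewrite /sform linearD /= map_mxD mulmxDr [LHS]mxE. Qed.

Lemma sformZl n (A : 'M[C]_n) c y z : sform A (c *: y) z = c * sform A y z.
Proof. by rewrite /sform -!scalemxAl [LHS]mxE. Qed.

Lemma sformZr n (A : 'M[C]_n) c y z : sform A y (c *: z) = c^* * sform A y z.
Proof. by rewrite /sform linearZ /= map_mxZ -scalemxAr [LHS]mxE. Qed.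

Lemma sformDm n (A B : 'M[C]_n) y z :
  sform (A + B) y z = sform A y z + sform B y z.
Proof. by rewrite /sform mulmxDr mulmxDl [LHS]mxE. Qed.

Lemma sformZm n (A : 'M[C]_n) c y z : sform (c *: A) y z = c * sform A y z.
Proof. by rewrite /sform -scalemxAr -scalemxAl [LHS]mxE. Qed.

Lemma sform_conj n (A : 'M[C]_n) y z : (sform A y z)^* = sform (A ^t*) z y.
Proof.
rewrite /sform -[in RHS](trmxCK z) -mulmxA -trmxC_mul -trmxC_mul mulmxA.
by rewrite [in RHS]mxE [in RHS]mxE.
Qed.

Lemma sform_delta n (A : 'M[C]_n) i j :
  sform A (delta_mx 0 i) (delta_mx 0 j) = A i j.
Proof.
rewrite /sform -rowE mxE (bigD1 j) //= big1 ?addr0.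
  by rewrite !mxE !eqxx conjC1 mulr1.
by move=> k kj; rewrite !mxE eqxx (negbTE kj) conjC0 mulr0.
Qed.

(** Polarization: the values at [e_i + c e_j] for [c = 1] and [c = i] determine
    the entries at [(i, j)] and [(j, i)]. *)
Lemma real_form_hermitian n (A : 'M[C]_n) :
  (forall z, sform A z z \is Num.real) -> A ^t* = A.
Proof.
move=> Areal; pose B := A ^t* - A.
have B0 z : sform B z z = 0.
  by rewrite sformDm -scaleN1r sformZm mulN1r -sform_conj (CrealP (Areal z)) subrr.
suff: B = 0 by move/eqP; rewrite subr_eq0 => /eqP.
apply/matrixP => i j; rewrite [RHS]mxE.
have polar (c : C) : c^* * B i j + c * B j i = 0.
  have := B0 (delta_mx 0 i + c *: delta_mx 0 j).
  rewrite !(sformDl, sformDr) !(sformZl, sformZr) !B0 !sform_delta.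
  by rewrite !mulr0 addr0 add0r.
have := polar 1; have := polar 'i.
rewrite conjC1 !mul1r conjCi mulNr => /eqP.
rewrite addrC subr_eq0 => /eqP /(mulfI (neq0Ci C)) -> /eqP.
by rewrite -mulr2n mulrn_eq0 /= => /eqP.
Qed.

Lemma hermsymmxE n (A : 'M[C]_n) : A ^t* = A -> A \is hermsymmx.
Proof. by move=> AE; apply/is_hermitianmxP; rewrite expr0 scale1r AE. Qed.

Lemma spectral_hermitian n (A : 'M[C]_n) : A ^t* = A ->
  exists (P : 'M[C]_n) (d : 'rV[C]_n),
    P *m P ^t* = 1%:M /\ A = P ^t* *m diag_mx d *m P.
Proof.
move=> /hermsymmxE/hermitian_normalmx/orthomx_spectralP AE.
exists (spectralmx A), (spectral_diag A).
have Pu := spectral_unitarymx A.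
by split; [exact/unitarymxP | rewrite {1}AE invmx_unitary].
Qed.

Lemma sform_row n (A P : 'M[C]_n) i j :
  sform A (row i P) (row j P) = (P *m A *m P ^t*) i j.
Proof.
rewrite /sform -row_mul [RHS]mxE mxE; apply: eq_bigr => k _.
by rewrite !mxE.
Qed.

(** By the spectral theorem, as [c] bounds every eigenvalue from below. *)
Lemma det_ge n (A : 'M[C]_n) (c : C) : 0 <= c ->
  (forall z, c * sform 1%:M z z <= sform A z z) -> c ^+ n <= \det A.
Proof.
move=> c0 Age; have s1 z : 0 <= sform 1%:M z z.
  rewrite /sform mulmx1 mxE; apply: sumr_ge0 => k _.
  by rewrite !mxE mul_conjC_ge0.
have /real_form_hermitian/spectral_hermitian[P [d [P1 AE]]] :
    forall z, sform A z z \is Num.real.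
  by move=> z; rewrite ger0_real // (le_trans _ (Age z)) // mulr_ge0.
have dE i : d 0 i = sform A (row i P) (row i P).
  by rewrite sform_row AE !mulmxA P1 mul1mx -mulmxA P1 mulmx1 mxE eqxx.
have -> : \det A = \prod_i d 0 i.
  rewrite AE !det_mulmx mulrAC -det_mulmx (mulmx1C P1) det1 mul1r det_diag //.
rewrite -[X in c ^+ X]card_ord -prodr_const; apply: ler_prod => i _.
rewrite c0 /= dE; apply: le_trans (Age _).
by rewrite sform_row mulmx1 P1 mxE eqxx mulr1.
Qed.

(** Scale the rows of a unitary diagonalization by the inverse square roots of
    the eigenvalues. *)
Lemma posdef_orthonormalize n (S : 'M[C]_n) :
  (forall z, z != 0 -> 0 < sform S z z) ->
  exists2 L : 'M[C]_n, L *m S *m L ^t* = 1%:M & L \in unitmx.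
Proof.
move=> Spos.
have /real_form_hermitian/spectral_hermitian[P [d [P1 SE]]] :
    forall z, sform S z z \is Num.real.
  move=> z; have [->|/Spos/gtr0_real//] := eqVneq z 0.
  by rewrite -(scale0r 0) sformZl mul0r rpred0.
have Pu : P \in unitmx by have [] := mulmx1_unit P1.
have PSP : P *m S *m P ^t* = diag_mx d.
  by rewrite SE !mulmxA P1 mul1mx -mulmxA P1 mulmx1.
have d0 i : 0 < d 0 i.
  have -> : d 0 i = sform S (row i P) (row i P).
    by rewrite sform_row PSP mxE eqxx.
  apply: Spos; apply/eqP => /(congr1 (mulmx^~ (invmx P))).
  rewrite -row_mul mulmxV // mul0mx => /rowP/(_ i).
  by rewrite !mxE eqxx => /eqP; rewrite oner_eq0.
pose e : 'rV[C]_n := \row_i (sqrtC (d 0 i))^-1.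
have e_real i : ((sqrtC (d 0 i))^-1)^* = (sqrtC (d 0 i))^-1.
  apply/CrealP; rewrite ger0_real // invr_ge0 sqrtC_ge0 ltW //.
exists (diag_mx e *m P).
  rewrite trmxC_mul !mulmxA -(mulmxA _ P) -(mulmxA _ _ (P ^t*)) PSP.
  rewrite tr_diag_mx map_diag_mx !mulmx_diag.
  apply/matrixP => i j; rewrite !mxE; case: eqVneq => //= _.
  rewrite e_real !mulr1n mulrAC -expr2 exprVn sqrtCK mulVf //.
  by rewrite gt_eqF.
rewrite unitmx_mul Pu andbT unitmxE det_diag unitfE.
apply/prodf_neq0 => i _; rewrite mxE invr_eq0 sqrtC_eq0 gt_eqF //.
Qed.

End HermitianForms.

(** * Powers of a 2-form under a change of basis *)

Section WedgePower.
Context {R : realType} {n : nat}.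
Implicit Types (A G : 'M[R[i]]_(n + n)) (f : 'I_(n + n) -> 'I_(n + n)).

Lemma det_cols G f :
  \sum_(s : 'S_(n + n)) (-1) ^+ s * \prod_j G (s j) (f j) =
  \det (\matrix_(j, l) G l (f j)).
Proof. by apply: eq_bigr => s _; congr (_ * _); apply: eq_bigr => j _; rewrite mxE. Qed.

Lemma det_cols_perm G (t : 'S_(n + n)) :
  \det (\matrix_(j, l) G l (t j)) = (-1) ^+ t * \det G.
Proof.
rewrite -(det_tr G) -det_perm -det_mulmx -row_permE; congr (\det _).
by apply/matrixP => j l; rewrite !mxE.
Qed.

Lemma det_cols_noninj G f : ~~ injectiveb f -> \det (\matrix_(j, l) G l (f j)) = 0.
Proof.
move=> /injectivePn[i1 [i2 ne12 fE]].
by apply: (determinant_alternate ne12) => l; rewrite !mxE fE.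
Qed.

(** Expanding the product over all index maps [f], the coefficient of
    [\prod_k A (f (lshift n k)) (f (rshift n k))] is the determinant of the
    matrix whose columns are those of [G] selected by [f]. *)
Lemma wedge_power_congr A G :
  wedge_power (G *m A *m G^T) = \det G * wedge_power A.
Proof.
rewrite /wedge_power mulrCA; congr (_ * _).
pose pairs := {ffun 'I_n -> 'I_(n + n) * 'I_(n + n)}.
pose phi (g : {ffun 'I_(n + n) -> 'I_(n + n)}) : pairs :=
  [ffun k => (g (lshift n k), g (rshift n k))].
have phi_bij : bijective phi.
  exists (fun h : pairs => [ffun j : 'I_(n + n) =>
    match fintype.split j with inl k => (h k).1 | inr k => (h k).2 end]).
    move=> g; apply/ffunP => j; rewrite !ffunE.
    by case: splitP => k jk; rewrite ffunE /=; congr (g _); apply: val_inj.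
  move=> h; apply/ffunP => k; rewrite !ffunE.
  have -> : fintype.split (lshift n k) = inl k.
    by rewrite -[lshift n k]/(unsplit (inl k)) unsplitK.
  have -> : fintype.split (rshift n k) = inr k.
    by rewrite -[rshift n k]/(unsplit (inr k)) unsplitK.
  by case: (h k).
have entryE x y : (G *m A *m G^T) x y =
    \sum_(p : 'I_(n + n) * 'I_(n + n)) A p.1 p.2 * (G x p.1 * G y p.2).
  rewrite -(pair_bigA _ (fun a b => A a b * (G x a * G y b))) /= exchange_big /= mxE.
  apply: eq_bigr => b _; rewrite !mxE big_distrl /=; apply: eq_bigr => a _.
  by rewrite mulrCA mulrA.
have prodE (s : 'S_(n + n)) :
    \prod_(k < n) (G *m A *m G^T) (s (lshift n k)) (s (rshift n k)) =
    \sum_(g : {ffun 'I_(n + n) -> 'I_(n + n)})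
      \prod_(k < n) A (g (lshift n k)) (g (rshift n k)) * \prod_j G (s j) (g j).
  under eq_bigr => k _ do rewrite entryE.
  rewrite bigA_distr_bigA /= (reindex phi) /=; last by apply: onW_bij.
  apply: eq_bigr => g _; rewrite big_split_ord /= -!big_split /=.
  by apply: eq_bigr => k _; rewrite ffunE.
under eq_bigr => s _ do rewrite prodE big_distrr /=.
rewrite exchange_big /=.
under eq_bigr => g _.
  under eq_bigr => s _ do rewrite mulrCA.
  rewrite -big_distrr /= det_cols.
  over.
rewrite (bigID (fun g : {ffun 'I_(n + n) -> 'I_(n + n)} => injectiveb g)) /=.
rewrite [X in _ + X]big1 ?addr0; last first.
  by move=> g ng; rewrite det_cols_noninj ?mulr0.
rewrite big_distrr /=.
rewrite (reindex (@pval _)) /=; last first.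
  pose in_Sn := insubd (1%g : 'S_(n + n)).
  by exists in_Sn => /= f Uf; first apply: val_inj; apply: insubdK.
apply: eq_big => [s|s _]; first by rewrite (valP s).
have -> : (\matrix_(j, l) G l (pval s j)) = \matrix_(j, l) G l (s j).
  by apply/matrixP => j l; rewrite !mxE pvalE.
rewrite det_cols_perm mulrA [RHS]mulrC; congr (_ * _).
rewrite mulrC; congr (_ * _); apply: eq_bigr => k _.
by rewrite pvalE.
Qed.

End WedgePower.

(** * Unitary frames and the ratio of volume forms *)

Section HermitianStructure.
Context {R : realType} {n : nat}.
Implicit Types (A : 'M[R[i]]_(n + n)).

Lemma conjC_real (x : R) : (real_complex R x)^* = real_complex R x.
Proof. by apply/CrealP; rewrite complex_real. Qed.

Lemma conjC_i : ('i%C : R[i])^* = - 'i%C.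
Proof. by rewrite complexiE conjCi. Qed.

Lemma ii_C : 'i%C * 'i%C = -1 :> R[i].
Proof. by rewrite -expr2 sqr_i. Qed.

Lemma complexifyM p q r (A : 'M[R]_(p, q)) (B : 'M[R]_(q, r)) :
  complexify (A *m B) = complexify A *m complexify B.
Proof. exact: map_mxM. Qed.

Lemma complexify_tr p q (A : 'M[R]_(p, q)) : (complexify A)^T = complexify A^T.
Proof. by rewrite /complexify map_trmx. Qed.

Lemma complexify_conj p q (A : 'M[R]_(p, q)) : map_mx Num.conj (complexify A) = complexify A.
Proof. by apply/matrixP => i j; rewrite !mxE conjC_real. Qed.

Lemma complexify_row (Y : 'rV[R[i]]_(n + n)) :
  exists a b, Y = complexify a + 'i%C *: complexify b.
Proof.
exists (map_mx (@complex.Re R) Y), (map_mx (@complex.Im R) Y).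
by apply/rowP => j; rewrite !mxE -complexE.
Qed.

Lemma sform_complexify (g : 'M[R]_(n + n)) a b :
  sform (complexify g) (complexify a) (complexify b) =
  real_complex R ((a *m g *m b^T) 0 0).
Proof. by rewrite /sform -map_trmx complexify_conj complexify_tr -!complexifyM mxE. Qed.

Lemma metric_herm_pos (g : 'M[R]_(n + n)) : g^T = g ->
  (forall Y : 'rV[R]_(n + n), Y != 0 -> 0 < (Y *m g *m Y^T) 0 0) ->
  forall Y : 'rV[R[i]]_(n + n), Y != 0 -> 0 < sform (complexify g) Y Y.
Proof.
move=> gT gpos Y; have [a [b ->]] := complexify_row Y => ab0.
rewrite !(sformDl, sformDr, sformZl, sformZr) !sform_complexify conjC_i.
have -> : (b *m g *m a^T) 0 0 = (a *m g *m b^T) 0 0.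
  rewrite -[in LHS]gT -{1}(trmxK b) -trmx_mul -[in LHS]trmx_mul mulmxA.
  by rewrite [LHS]mxE.
rewrite [in X in _ < X]mulNr addrA subrK mulrA mulrN ii_C opprK mul1r.
have ge0 (c : 'rV[R]_(n + n)) : 0 <= (c *m g *m c^T) 0 0.
  by have [->|/gpos/ltW//] := eqVneq c 0; rewrite !mul0mx mxE.
rewrite -rmorphD /= ltcR; case: (eqVneq a 0) ab0 => [->|/gpos a0 _].
  rewrite {1}/complexify map_mx0 add0r => b0.
  apply: ltr_wpDl (ge0 _) (gpos _ _); apply: contraNneq b0 => ->.
  by rewrite /complexify map_mx0 scaler0.
exact: ltr_wpDr (ge0 _) a0.
Qed.

End HermitianStructure.

Section UnitaryFrame.
Context {R : realType} {n : nat}.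
Variables J g : 'M[R]_(n + n).
Hypotheses (J2 : J *m J = - 1%:M) (gJ : J *m g *m J^T = g) (gT : g^T = g).
Hypothesis gpos : forall Y : 'rV[R]_(n + n), Y != 0 -> 0 < (Y *m g *m Y^T) 0 0.

Lemma complexify_sqr : complexify J *m complexify J = - 1%:M.
Proof. by rewrite -complexifyM J2 /complexify map_mxN map_mx1. Qed.

Lemma proj10J : proj10 J *m complexify J = 'i%C *: proj10 J.
Proof.
rewrite /proj10 -scalemxAl mulmxBl mul1mx -scalemxAl complexify_sqr scalerN opprK.
rewrite [RHS]scalerA mulrC -[RHS]scalerA scalerBr scalerA ii_C scaleN1r opprK.
by rewrite addrC.
Qed.

Lemma proj_sum : proj10 J + proj01 J = 1%:M.
Proof.
rewrite /proj10 /proj01 -scalerDr addrACA addNr addr0.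
rewrite -[X in _ *: (X + X)]scale1r -scalerDl scalerA.
by rewrite mulVf ?scale1r // pnatr_eq0.
Qed.

Lemma T10_proj01 k (E : 'M[R[i]]_(k, n + n)) :
  E *m complexify J = 'i%C *: E -> E *m proj01 J = 0.
Proof.
move=> EJ; rewrite /proj01 -scalemxAr mulmxDr mulmx1 -scalemxAr EJ scalerA ii_C.
by rewrite scaleN1r subrr scaler0.
Qed.

Lemma T10_proj10 k (E : 'M[R[i]]_(k, n + n)) :
  E *m complexify J = 'i%C *: E -> E *m proj10 J = E.
Proof.
by move=> /T10_proj01 E0; rewrite -[RHS]mulmx1 -proj_sum mulmxDr E0 addr0.
Qed.

Lemma conj_proj01 : map_mx Num.conj (proj01 J) = proj10 J.
Proof.
rewrite /proj01 map_mxZ map_mxD map_mxZ complexify_conj map_mx1 fmorphV rmorph_nat /=.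
by rewrite conjC_i scaleNr.
Qed.

(** The projections onto T_{1,0} and T_{0,1} are complex conjugate, hence of
    equal rank, and complementary. *)
Lemma rank_proj10 : \rank (proj10 J) = n.
Proof.
have r01 : \rank (proj01 J) = \rank (proj10 J) by rewrite -conj_proj01 mxrank_map.
have lo : (n + n <= \rank (proj10 J) + \rank (proj01 J))%N.
  by rewrite -{1}(mxrank1 R[i] (n + n)) -proj_sum mxrank_add.
have hi : (\rank (proj10 J) + \rank (proj01 J) <= n + n)%N.
  apply: mulmx0_rank_max; exact/T10_proj01/proj10J.
have := conj lo hi; rewrite r01 => -[lo' hi'].
have /eqP : (\rank (proj10 J)).*2 = n.*2 by apply/eqP; rewrite eqn_leq -!addnn lo' hi'.
by rewrite -!muln2 eqn_pmul2r // => /eqP.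
Qed.

(** The row space of [proj10 J] is T_{1,0}; a basis of it is orthonormalized for
    the Hermitian extension of [g]. *)
Lemma exists_unitary_frame : exists E : 'M[R[i]]_(n, n + n),
  [/\ E *m complexify J = 'i%C *: E, E *m complexify g *m E ^t* = 1%:M &
   forall Y : 'rV[R[i]]_(n + n), Y *m complexify J = 'i%C *: Y ->
     exists z, Y = z *m E].
Proof.
have : exists B : 'M[R[i]]_(\rank (proj10 J), n + n), (B :=: proj10 J)%MS.
  by exists (row_base (proj10 J)); exact: eq_row_base.
rewrite rank_proj10 => -[B BP].
have Bfree : row_free B by rewrite /row_free BP rank_proj10.
have BJ : B *m complexify J = 'i%C *: B.
  have /submxP[D ->] : (B <= proj10 J)%MS by rewrite BP.
  by rewrite -mulmxA proj10J scalemxAr.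
have [z z0|L LB Lunit] := @posdef_orthonormalize _ _ (B *m complexify g *m B ^t*).
  have -> : sform (B *m complexify g *m B ^t*) z z =
            sform (complexify g) (z *m B) (z *m B).
    by rewrite /sform trmxC_mul !mulmxA.
  apply: metric_herm_pos => //; apply: contra z0.
  by rewrite -(mul0mx 1 B) => /eqP/(row_free_inj Bfree)->.
exists (L *m B); split.
- by rewrite -mulmxA BJ scalemxAr.
- by rewrite trmxC_mul !mulmxA in LB *.
- move=> Y YJ; apply/submxP.
  rewrite (eqmxMfull B) ?row_full_unit // BP -(T10_proj10 YJ); exact: submxMl.
Qed.

(** In the frame [E, conj E] an alternating form of type (1,1) has the block
    matrix [[0, h], [- h^T, 0]], which is congruent to the standard symplectic
    matrix via [diag (h, 1)]. *)
Lemma wedge_power_frame (E : 'M[R[i]]_(n, n + n)) (A : 'M[R[i]]_(n + n)) :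
  A^T = - A -> E *m A *m E^T = 0 -> map_mx Num.conj E *m A *m E ^t* = 0 ->
  \det (col_mx E (map_mx Num.conj E)) * wedge_power A =
  \det (E *m A *m E ^t*) * wedge_power (block_mx 0 1%:M (- 1%:M) 0 : 'M[R[i]]_(n + n)).
Proof.
move=> AT A20 A02; rewrite -wedge_power_congr.
set h := E *m A *m E ^t*.
have -> : \det h = \det (block_mx h 0 0 1%:M : 'M[R[i]]_(n + n)).
  by rewrite det_ublock det1 mulr1.
rewrite -wedge_power_congr; congr wedge_power.
rewrite tr_col_mx mul_col_mx mul_col_row A20 map_trmx A02 tr_block_mx !mulmx_block.
rewrite !trmx0 !trmx1 !(mulmx0, mul0mx, mulmx1, mul1mx, addr0, add0r, mulNmx).
congr (block_mx _ _ _ _).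
by rewrite /h !trmx_mul map_trmx trmxK AT mulNmx mulmxN opprK mulmxA.
Qed.

(** [g] vanishes on pairs of (1,0) vectors, as [J] preserves [g] and acts on such
    pairs by [i * i = -1]. Hence the Gram matrix of [E, conj E] is the
    identity. *)
Lemma det_unitary_frame (E : 'M[R[i]]_(n, n + n)) :
  E *m complexify J = 'i%C *: E -> E *m complexify g *m E ^t* = 1%:M ->
  E *m complexify g *m E^T = 0 /\ \det (col_mx E (map_mx Num.conj E)) != 0.
Proof.
move=> EJ Eg.
have Eg0 : E *m complexify g *m E^T = 0.
  have : E *m complexify g *m E^T = - (E *m complexify g *m E^T).
    rewrite -{1}gJ !complexifyM -complexify_tr !mulmxA EJ -!mulmxA -trmx_mul EJ.
    by rewrite linearZ /= -!scalemxAr -scalemxAl scalerA ii_C scaleN1r !mulmxA.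
  set X := (X in X = - X) => XN; have : (2 : R[i]) *: X = 0.
    by rewrite (natrD _ 1 1) scalerDl !scale1r {1}XN addNr.
  by move/eqP; rewrite scaler_eq0 pnatr_eq0 => /eqP.
split=> //.
have Eg0' : map_mx Num.conj E *m complexify g *m E ^t* = 0.
  rewrite -(complexify_conj g) -!map_mxM Eg0 map_mx0 //.
have Eg1 : map_mx Num.conj E *m complexify g *m E^T = 1%:M.
  have -> : E^T = map_mx Num.conj (E ^t*).
    by apply/matrixP => i j; rewrite !mxE conjCK.
  by rewrite -(complexify_conj g) -!map_mxM Eg map_mx1.
have : col_mx E (map_mx Num.conj E) *m (complexify g *m row_mx (E ^t*) E^T) = 1%:M.
  rewrite mulmxA mul_col_mx mul_col_row Eg Eg0 Eg0' Eg1.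
  by rewrite -scalar_mx_block.
by case/mulmx1_unit => + _; rewrite unitmxE unitfE.
Qed.

Lemma part11_antisym (P Q alpha : 'M[R[i]]_(n + n)) : alpha^T = - alpha ->
  (P *m alpha *m Q^T + Q *m alpha *m P^T)^T =
  - (P *m alpha *m Q^T + Q *m alpha *m P^T).
Proof.
move=> alphaT; rewrite linearD /= !trmx_mul !trmxK alphaT.
by rewrite !mulNmx !mulmxN !mulmxA addrC opprD.
Qed.

Lemma part11_pure (P Q alpha : 'M[R[i]]_(n + n)) k (E : 'M[R[i]]_(k, n + n)) :
  E *m Q = 0 -> E *m (P *m alpha *m Q^T + Q *m alpha *m P^T) *m E^T = 0.
Proof.
move=> EQ; rewrite mulmxDr mulmxDl !mulmxA EQ !mul0mx addr0.
by rewrite -mulmxA -trmx_mul EQ trmx0 mulmx0.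
Qed.

(** In the frame [E, conj E] both forms are alternating of type (1,1), given by
    [i h] with [h] the complex Hessian for the first, and by [i] for the second. *)
Lemma wedge_power_ratio (E : 'M[R[i]]_(n, n + n)) (alpha : 'M[R[i]]_(n + n)) :
  E *m complexify J = 'i%C *: E -> E *m complexify g *m E ^t* = 1%:M ->
  alpha^T = - alpha ->
  wedge_power ('i%C *: part11 J alpha) =
  \det (E *m part11 J alpha *m E ^t*) * wedge_power (complexify (J *m g)).
Proof.
move=> EJ Eg alphaT; have [Eg0 detF] := det_unitary_frame EJ Eg.
have E01 := T10_proj01 EJ.
have E10 : map_mx Num.conj E *m proj10 J = 0.
  by rewrite -conj_proj01 -map_mxM E01 map_mx0.
have cEJ : map_mx Num.conj E *m complexify J = - 'i%C *: map_mx Num.conj E.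
  by rewrite -(complexify_conj J) -map_mxM EJ map_mxZ /= conjC_i.
have A20 := part11_pure (proj10 J) alpha E01.
have A02 := part11_pure (proj01 J) alpha E10.
have AT := part11_antisym (proj10 J) (proj01 J) alphaT.
rewrite addrC map_trmx in A02.
rewrite /part11; move: (proj10 J *m alpha *m _ + _) A20 A02 AT => A A20 A02 AT.
apply: (mulfI detF); rewrite [RHS]mulrCA.
rewrite wedge_power_frame.
- rewrite wedge_power_frame.
  + rewrite complexifyM !mulmxA EJ -!scalemxAl Eg -scalemxAr -scalemxAl.
    rewrite !detZ det1 mulr1; move: (wedge_power (block_mx _ _ _ _)) => W.
    by rewrite [RHS]mulrCA [RHS]mulrA.
  + rewrite complexify_tr trmx_mul gT -{1}gJ -!mulmxA.
    have -> : J^T *m J^T = - 1%:M by rewrite -trmx_mul J2 linearN /= trmx1.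
    by rewrite !mulmxN mulmx1 /complexify map_mxN.
  + by rewrite complexifyM !mulmxA EJ -!scalemxAl Eg0 scaler0.
  + rewrite complexifyM !mulmxA cEJ -!scalemxAl.
    by rewrite -(complexify_conj g) -!map_mxM Eg0 map_mx0 scaler0.
- by rewrite linearZ /= AT scalerN.
- by rewrite -scalemxAr -scalemxAl A20 scaler0.
- by rewrite -scalemxAr -scalemxAl A02 scaler0.
Qed.

End UnitaryFrame.

(** * Functions of class C^k on open subsets of R^m *)

Lemma near_eq_differentiable (R : numFieldType) (V W : normedModType R)
    (f g : V -> W) (x : V) :
  (\forall y \near x, f y = g y) -> differentiable f x -> differentiable g x.
Proof.
move=> fg df; have fgx := nbhs_singleton fg.
have gE : g \o shift x = cst (g x) + 'd f x +o_ 0 id.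
  apply/eqaddoP => e e0.
  have /eqaddoP/(_ e e0) := diff_locally df.
  have : \forall y \near (0 : V), f (y + x) = g (y + x).
    by move: fg; rewrite (near_shift 0) subr0.
  apply: filterS2 => y /= fgy.
  by rewrite !fctE /= fgy fgx.
have dg : 'd g x = 'd f x :> (V -> W).
  by apply: diff_unique gE; exact: diff_continuous.
by apply/diff_locallyP; rewrite dg; split => //; exact: diff_continuous.
Qed.

Section CkCalculus.
Context {R : realType} {m : nat}.
Implicit Types (U : set 'rV[R]_m) (f g : 'rV[R]_m -> R) (a : 'rV[R]_m).

Lemma Ck_differentiable k U f x : Ck k.+1 U f -> U x -> differentiable f x.
Proof. by case=> df _; exact: df. Qed.

Lemma Ck_derive k U f (a : 'I_m) : Ck k.+1 U f -> Ck k U ('D_(delta_mx 0 a) f).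
Proof. by case=> _; exact. Qed.

Lemma CkS k U f : Ck k.+1 U f -> Ck k U f.
Proof.
elim: k f => [|k IH] f [df Df]; first by move=> x /df/differentiable_continuous.
by split=> // a; apply: IH.
Qed.

Lemma Ck_continuous k U f x : Ck k U f -> U x -> {for x, continuous f}.
Proof. by elim: k f => [|k IH] f; [exact | move/CkS; exact: IH]. Qed.

Lemma Ck_sub k U U' f : U' `<=` U -> Ck k U f -> Ck k U' f.
Proof.
move=> sU; elim: k f => [|k IH] f; first by move=> cf x /sU; exact: cf.
by move=> [df Df]; split=> [x /sU /df //|a]; exact: IH (Df a).
Qed.

Lemma CkU k U U' f : Ck k U f -> Ck k U' f -> Ck k (U `|` U') f.
Proof.
elim: k f => [|k IH] f; first by move=> cf cf' x [/cf|/cf'].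
by move=> [df Df] [df' Df']; split=> [x [/df|/df']//|a]; exact: IH (Df a) (Df' a).
Qed.

Lemma nearU U x (P : 'rV[R]_m -> Prop) : open U -> U x ->
  (forall y, U y -> P y) -> \forall y \near x, P y.
Proof.
move=> oU Ux UP; have xU : nbhs x U by exact: open_nbhs_nbhs.
exact: filterS xU.
Qed.

Lemma derive_congr U f g a x : open U -> U x -> (forall y, U y -> f y = g y) ->
  'D_a f x = 'D_a g x.
Proof. by move=> oU Ux fg; apply: near_eq_derive; exact: nearU fg. Qed.

Lemma differentiable_congr U f g x : open U -> U x ->
  (forall y, U y -> f y = g y) -> differentiable f x -> differentiable g x.
Proof. by move=> oU Ux fg; apply: near_eq_differentiable; exact: nearU fg. Qed.

Lemma Ck_congr k U f g : open U -> (forall x, U x -> f x = g x) ->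
  Ck k U f -> Ck k U g.
Proof.
move=> oU; elim: k f g => [|k IH] f g fg.
  move=> cf x Ux; suff : g y @[y --> x] --> f x by rewrite fg.
  have fgx : \forall y \near x, f y = g y by exact: nearU fg.
  by apply: cvg_trans (cf x Ux); exact: near_eq_cvg fgx.
move=> [df Df]; split=> [x Ux|a]; first exact: differentiable_congr fg (df x Ux).
by apply: IH (Df a) => x Ux; exact: derive_congr fg.
Qed.

Lemma Ck_cst k U (c : R) : Ck k U (cst c).
Proof.
elim: k c => [|k IH] c; first by move=> x _; exact: cst_continuous.
split=> [x _|a]; first exact: differentiable_cst.
by rewrite (_ : 'D_ _ _ = cst 0) //; apply/funext => x; rewrite derive_cst.
Qed.

Lemma CkD k U f g : open U -> Ck k U f -> Ck k U g -> Ck k U (fun x => f x + g x).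
Proof.
move=> oU; elim: k f g => [|k IH] f g.
  by move=> cf cg x Ux; exact: (continuousD (cf x Ux) (cg x Ux)).
move=> [df Df] [dg Dg]; split=> [x Ux|a].
  by apply: differentiableD; [exact: df|exact: dg].
apply: Ck_congr oU _ (IH _ _ (Df a) (Dg a)) => x Ux.
by rewrite [RHS]deriveD //; apply: diff_derivable; [exact: df|exact: dg].
Qed.

Lemma CkM k U f g : open U -> Ck k U f -> Ck k U g -> Ck k U (fun x => f x * g x).
Proof.
move=> oU; elim: k f g => [|k IH] f g.
  by move=> cf cg x Ux; exact: (continuousM (cf x Ux) (cg x Ux)).
move=> Cf Cg; have [df Df] := Cf; have [dg Dg] := Cg; split=> [x Ux|a].
  by apply: differentiableM; [exact: df|exact: dg].
apply: Ck_congr oU _ (CkD oU (IH _ _ (CkS Cf) (Dg a)) (IH _ _ (CkS Cg) (Df a))).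
move=> x Ux.
by rewrite [RHS]deriveM //; apply: diff_derivable; [exact: df|exact: dg].
Qed.

Lemma CkZ k U (c : R) f : open U -> Ck k U f -> Ck k U (fun x => c * f x).
Proof. by move=> oU; apply: CkM => //; exact: Ck_cst. Qed.

Lemma Ck_sum k U (I : Type) (r : seq I) (f : I -> 'rV[R]_m -> R) : open U ->
  (forall i, Ck k U (f i)) -> Ck k U (fun x => \sum_(i <- r) f i x).
Proof.
move=> oU Cf; elim: r => [|i r IH].
  by apply: Ck_congr oU _ (Ck_cst k U 0) => x _; rewrite big_nil.
by apply: Ck_congr oU _ (CkD oU (Cf i) IH) => x _; rewrite big_cons.
Qed.

(** The counterpart of [Ck] for functions of one variable on the whole line. *)
Fixpoint Ck1 (k : nat) (G : R -> R) : Prop :=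
  if k is k'.+1 then (forall t, derivable G t 1) /\ Ck1 k' G^`()%classic
  else continuous G.

Lemma derive_comp1 f (G : R -> R) a x :
  differentiable f x -> derivable G (f x) 1 ->
  'D_a (G \o f) x = G^`()%classic (f x) * 'D_a f x.
Proof.
move=> df dG; have dG' := (derivable1_diffP _ _).1 dG.
rewrite !deriveE //; last exact: differentiable_comp.
by rewrite diff_comp //= diff1E // mulrC.
Qed.

Lemma Ck_comp1 k U f (G : R -> R) : open U -> Ck1 k G -> Ck k U f ->
  Ck k U (G \o f).
Proof.
move=> oU; elim: k f G => [|k IH] f G CG Cf.
  by move=> x Ux; apply: continuous_comp; [exact: (Cf x Ux) | exact: CG].
have [dG DG] := CG; have [df Df] := Cf; split=> [x Ux|a].
  by apply: differentiable_comp; [exact: df | exact/derivable1_diffP].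
apply: Ck_congr oU _ (CkM oU (IH _ _ DG (CkS Cf)) (Df a)) => x Ux.
by rewrite [RHS]derive_comp1 //; exact: df.
Qed.

End CkCalculus.

Section OneVariable.
Context {R : realType}.

Lemma Ck1_id : Ck1 2 (id : R -> R).
Proof.
have i1 : (id : R -> R)^`()%classic = cst 1 by apply/funext => x; rewrite derive1_id.
have i2 : (cst 1 : R -> R)^`()%classic = cst 0 by apply/funext => x; rewrite derive1_cst.
split=> [x|]; first exact: derivable_id.
rewrite i1; split=> [x|]; first exact: derivable_cst.
by rewrite i2; exact: cst_continuous.
Qed.

Lemma Ck1_expR k : Ck1 k (@expR R).
Proof.
elim: k => [|k IH]; first exact: continuous_expR.
split=> [t|]; first exact: derivable_expR.
rewrite (_ : _^`()%classic = expR) //; apply/funext => t.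
by rewrite derive1E -[RHS](congr1 (@^~ t) (derive_expR R)).
Qed.

Lemma derive1_expR (t : R) : expR^`()%classic t = expR t.
Proof. by rewrite derive1E -[RHS](congr1 (@^~ t) (derive_expR R)). Qed.

Lemma Ck1Z k (c : R) (G : R -> R) : Ck1 k G -> Ck1 k (fun t => c * G t).
Proof.
elim: k G => [|k IH] G; first by move=> cG t; apply: cvgM; [exact: cvg_cst|exact: cG].
move=> [dG DG]; split=> [t|]; first exact: derivableZ.
rewrite (_ : _^`()%classic = fun t => c * G^`()%classic t); first exact: IH.
by apply/funext => t; rewrite !derive1E [LHS]deriveZ.
Qed.

(** [posX 3] is of class C^2 and vanishes on the nonpositive numbers: cutoff
    functions are built from it. *)
Definition posX (k : nat) (t : R) : R := Num.max t 0 ^+ k.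

Lemma posX_continuous k : continuous (posX k).
Proof.
move=> t; apply: (@continuous_comp _ _ _ (id \max cst (0 : R)) (@GRing.exp R ^~ k)).
  by apply: (@continuous_max R R id (cst 0)); [exact: cvg_id | exact: cst_continuous].
exact: exprn_continuous.
Qed.

Lemma posX_is_derive k (t : R) : is_derive t (1 : R) (posX k.+2) (k.+2%:R * posX k.+1 t).
Proof.
have [t0|t0|->] := ltgtP t 0.
- rewrite {2}/posX max_r ?ltW // expr0n mulr0.
  apply: (near_eq_is_derive (f := cst 0)).
  near=> s; have s0 : s < 0 by near: s; exact: lt_nbhsl.
  by rewrite /posX max_r ?expr0n //= ltW.
- rewrite {2}/posX max_l ?ltW //.
  apply: (@near_eq_is_derive R R R (fun t : R => t ^+ k.+2)).
    near=> s; have s0 : 0 < s by near: s; exact: lt_nbhsr.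
    by rewrite /posX max_l //= ltW.
  apply: DeriveDef; first exact: exprn_derivable.
  by rewrite exp_derive /GRing.scale /= mulr1.
- (* the difference quotient of [posX k.+2] at 0 is [posX k.+1] *)
  have p0 j : posX j.+1 0 = 0 by rewrite /posX max_r // expr0n.
  rewrite p0 mulr0.
  have cv : (h^-1 *: (posX k.+2 (h *: 1 + 0) - posX k.+2 0)) @[h --> 0^'] --> (0 : R).
    have c1 : posX k.+1 h @[h --> (0 : R)^'] --> (0 : R).
      have := @posX_continuous k.+1 0; rewrite /continuous_at p0.
      exact: cvg_within_filter.
    apply: cvg_trans c1; apply: near_eq_cvg.
    near=> h; have h0 : h != 0 by near: h; exact: nbhs_dnbhs_neq.
    rewrite p0 subr0 addr0 /GRing.scale /= mulr1 /posX.
    case: (leP h 0) => hle; first by rewrite !expr0n mulr0.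
    by rewrite [_ ^+ k.+2]exprS mulKf.
  have d : derivable (posX k.+2) (0 : R) 1 by exact: cvgP cv.
  by apply: (DeriveDef d); exact: cvg_lim cv.
Unshelve. all: by end_near. Qed.

Lemma posX3_Ck1 : Ck1 2 (posX 3).
Proof.
have D k t := @posX_is_derive k t.
have E k : (posX k.+2)^`()%classic = fun t => k.+2%:R * posX k.+1 t.
  by apply/funext => t; rewrite derive1E; exact: derive_val.
split=> [t|]; first exact: ex_derive.
rewrite E; apply: Ck1Z; split=> [t|]; first exact: ex_derive.
by rewrite E; apply: (@Ck1Z 0); exact: posX_continuous.
Qed.

End OneVariable.

(** * The Levi form in coordinates *)

Section DdbarCalculus.
Context {R : realType} {n : nat}.
Local Notation V := 'rV[R]_(n + n).
Implicit Types (U : set V) (J : V -> 'M[R]_(n + n)) (v w : V -> R) (x y : V).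

Definition toC v : V -> R[i] := fun y => real_complex R (v y).

Lemma d0_toC v x c : d0 (toC v) x c 0 = real_complex R ('D_(delta_mx 0 c) v x).
Proof.
rewrite mxE /dpartial; congr Complex.
exact: derive_cst.
Qed.

Lemma delbar_toC J v y b : delbar J (toC v) y b 0 =
  Complex (2^-1 * 'D_(delta_mx 0 b) v y)
          (2^-1 * \sum_c J y b c * 'D_(delta_mx 0 c) v y).
Proof.
have half : 2^-1 = real_complex R 2^-1 by rewrite fmorphV rmorph_nat.
rewrite /delbar /part01 /proj01 -scalemxAl mxE half mulmxDl mul1mx mxE d0_toC.
rewrite -scalemxAl mxE mxE.
have -> : \sum_c complexify (J y) b c * d0 (toC v) y c 0 =
    real_complex R (\sum_c J y b c * 'D_(delta_mx 0 c) v y).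
  rewrite rmorph_sum; apply: eq_bigr => c _.
  by rewrite d0_toC mxE rmorphM.
by apply/eqP; rewrite eq_complex; simpc.
Qed.

Lemma d1E (beta : V -> 'cV[R[i]]_(n + n)) x a b : d1 beta x a b =
  dpartial a (fun y => beta y b 0) x - dpartial b (fun y => beta y a 0) x.
Proof. by rewrite mxE. Qed.

Lemma d1_congr (beta beta' : V -> 'cV[R[i]]_(n + n)) U x :
  open U -> U x -> (forall y, U y -> beta y = beta' y) -> d1 beta x = d1 beta' x.
Proof.
move=> oU Ux bE; apply/matrixP => a b; rewrite !mxE /dpartial.
by congr (Complex _ _ - Complex _ _); apply: derive_congr oU Ux _ => y /bE ->.
Qed.

Lemma ddbarE J v x : ddbar J v x = part11 (J x) (d1 (delbar J (toC v)) x).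
Proof. by []. Qed.

(** The regularity under which [dpartial], which differentiates real and
    imaginary parts separately, obeys the usual rules. *)
Definition Cdiff (f : V -> R[i]) x :=
  differentiable (fun y => complex.Re (f y)) x /\
  differentiable (fun y => complex.Im (f y)) x.

Lemma ReM_real (t : R) (z : R[i]) :
  complex.Re (real_complex R t * z) = t * complex.Re z.
Proof. by case: z => ? ? /=; rewrite mul0r subr0. Qed.

Lemma ImM_real (t : R) (z : R[i]) :
  complex.Im (real_complex R t * z) = t * complex.Im z.
Proof. by case: z => ? ? /=; rewrite mul0r addr0. Qed.

Lemma dpartialD (f g : V -> R[i]) a x : Cdiff f x -> Cdiff g x ->
  dpartial a (fun y => f y + g y) x = dpartial a f x + dpartial a g x.
Proof.
move=> [rf jf] [rg jg]; rewrite /dpartial.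
under [fun y => complex.Re _]eq_fun do rewrite raddfD.
under [fun y => complex.Im _]eq_fun do rewrite raddfD.
rewrite (deriveD (f := fun y => complex.Re (f y))); [|exact: diff_derivable..].
by rewrite (deriveD (f := fun y => complex.Im (f y))); [|exact: diff_derivable..].
Qed.

Lemma dpartialM (c : V -> R) (f : V -> R[i]) a x : differentiable c x -> Cdiff f x ->
  dpartial a (fun y => toC c y * f y) x =
  toC c x * dpartial a f x + real_complex R ('D_(delta_mx 0 a) c x) * f x.
Proof.
move=> dc [rf jf]; rewrite /dpartial.
under [fun y => complex.Re _]eq_fun do rewrite ReM_real.
under [fun y => complex.Im _]eq_fun do rewrite ImM_real.
rewrite (deriveM (g := fun y => complex.Re (f y))); [|exact: diff_derivable..].
rewrite (deriveM (g := fun y => complex.Im (f y))); [|exact: diff_derivable..].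
rewrite /toC; case: (f x) => u w; apply/eqP; rewrite eq_complex /GRing.scale /=.
by rewrite !mul0r !subr0 !addr0 ![_ * u]mulrC ![_ * w]mulrC !eqxx.
Qed.

Lemma d1D (beta beta' : V -> 'cV[R[i]]_(n + n)) x :
  (forall b, Cdiff (fun y => beta y b 0) x) ->
  (forall b, Cdiff (fun y => beta' y b 0) x) ->
  d1 (fun y => beta y + beta' y) x = d1 beta x + d1 beta' x.
Proof.
move=> db db'; apply/matrixP => a b; rewrite [RHS]mxE !d1E.
have E c d : dpartial c (fun y => (beta y + beta' y) d 0) x =
    dpartial c (fun y => beta y d 0) x + dpartial c (fun y => beta' y d 0) x.
  by under [fun y => _]eq_fun do rewrite mxE; rewrite dpartialD.
by rewrite !E opprD addrACA.
Qed.

(** Leibniz rule; the last two terms are [dc /\ beta]. *)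
Lemma d1M (c : V -> R) (beta : V -> 'cV[R[i]]_(n + n)) x :
  differentiable c x -> (forall b, Cdiff (fun y => beta y b 0) x) ->
  d1 (fun y => toC c y *: beta y) x = toC c x *: d1 beta x +
    (d0 (toC c) x *m (beta x)^T - beta x *m (d0 (toC c) x)^T).
Proof.
move=> dc db; apply/matrixP => a b.
rewrite [RHS]mxE [X in _ = X + _]mxE [X in _ = _ + X]mxE !d1E.
have E e d : dpartial e (fun y => (toC c y *: beta y) d 0) x =
    toC c x * dpartial e (fun y => beta y d 0) x +
    d0 (toC c) x e 0 * beta x d 0.
  by under [fun y => _]eq_fun do rewrite mxE; rewrite dpartialM // d0_toC.
rewrite [X in _ = _ + (X + _)]mxE big_ord1 [X in _ = _ + (_ + X)]mxE.
rewrite [X in _ = _ + (_ - X)]mxE big_ord1 ![_^T _ _]mxE !E.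
by rewrite mulrBr opprD addrACA [_ * beta x a 0]mulrC.
Qed.

Lemma part11D J (alpha alpha' : 'M[R[i]]_(n + n)) y :
  part11 (J y) (alpha + alpha') = part11 (J y) alpha + part11 (J y) alpha'.
Proof.
rewrite /part11; move: (proj10 (J y)) (proj01 (J y)) => P Q.
by rewrite !(mulmxDr, mulmxDl) addrACA.
Qed.

Lemma part11Z J t (alpha : 'M[R[i]]_(n + n)) y :
  part11 (J y) (t *: alpha) = t *: part11 (J y) alpha.
Proof.
rewrite /part11; move: (proj10 (J y)) (proj01 (J y)) => P Q.
by rewrite -!scalemxAr -!scalemxAl scalerDr.
Qed.

Section AtPoint.
Variables (U : set V) (J : V -> 'M[R]_(n + n)) (x : V).
Hypotheses (oU : open U) (Ux : U x).
Hypothesis CJ : forall a b, Ck 1 U (fun y => J y a b).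

Lemma delbar_Cdiff v b : Ck 2 U v -> Cdiff (fun y => delbar J (toC v) y b 0) x.
Proof.
move=> Cv; have CDv c : Ck 1 U ('D_(delta_mx 0 c) v) by exact: Ck_derive.
split; under eq_fun do rewrite delbar_toC /=.
  exact: Ck_differentiable (CkZ _ oU (CDv b)) Ux.
apply: (Ck_differentiable (CkZ 2^-1 oU _) Ux).
by apply: Ck_sum => // c; exact: CkM.
Qed.

Lemma delbarD v w y : differentiable v y -> differentiable w y ->
  delbar J (toC (fun y => v y + w y)) y = delbar J (toC v) y + delbar J (toC w) y.
Proof.
move=> dv dw; rewrite /delbar /part01 -mulmxDr.
suff -> : d0 (toC (fun y => v y + w y)) y = d0 (toC v) y + d0 (toC w) y by [].
apply/matrixP => c j; rewrite ord1 [RHS]mxE !d0_toC.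
by rewrite (deriveD (f := v)) ?rmorphD //; exact: diff_derivable.
Qed.

Lemma d0_comp (G : R -> R) v y : differentiable v y -> derivable G (v y) 1 ->
  d0 (toC (G \o v)) y = real_complex R (G^`()%classic (v y)) *: d0 (toC v) y.
Proof.
move=> dv dG; apply/matrixP => c j; rewrite ord1 [RHS]mxE !d0_toC.
by rewrite derive_comp1 // rmorphM.
Qed.

Lemma ddbarD v w : Ck 2 U v -> Ck 2 U w ->
  ddbar J (fun y => v y + w y) x = ddbar J v x + ddbar J w x.
Proof.
move=> Cv Cw; rewrite !ddbarE -part11D.
suff -> : d1 (delbar J (toC (fun y => v y + w y))) x =
    d1 (delbar J (toC v)) x + d1 (delbar J (toC w)) x by [].
rewrite -d1D; [|by move=> b; exact: delbar_Cdiff..].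
apply: (d1_congr oU Ux) => y Uy.
by apply: delbarD; [exact: Ck_differentiable Cv Uy|exact: Ck_differentiable Cw Uy].
Qed.

(** Leibniz rule for [delbar (G o v) = G'(v) delbar v]. *)
Lemma d1_delbar_comp (G : R -> R) v : Ck 2 U v -> Ck1 2 G ->
  d1 (delbar J (toC (G \o v))) x =
  real_complex R (G^`()%classic (v x)) *: d1 (delbar J (toC v)) x +
  real_complex R (G^`()^`()%classic (v x)) *:
    (d0 (toC v) x *m (delbar J (toC v) x)^T - delbar J (toC v) x *m (d0 (toC v) x)^T).
Proof.
move=> Cv [dG [ddG _]]; have dv y : U y -> differentiable v y.
  by move=> Uy; exact: Ck_differentiable Cv Uy.
pose beta y := toC (G^`()%classic \o v) y *: delbar J (toC v) y.
rewrite (@d1_congr _ beta U) //; last first.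
  by move=> y Uy; rewrite /beta /delbar /part01 scalemxAr d0_comp //; exact: dv.
have dGv : differentiable (G^`()%classic \o v) x.
  by apply: differentiable_comp; [exact: dv | exact/derivable1_diffP].
rewrite /beta d1M //; last by move=> b; exact: delbar_Cdiff.
congr (_ + _); rewrite d0_comp //; last exact: dv.
by rewrite linearZ /= -scalemxAl -scalemxAr scalerBr.
Qed.

Lemma ddbarZ v (t : R) : Ck 2 U v ->
  ddbar J (fun y => t * v y) x = real_complex R t *: ddbar J v x.
Proof.
move=> Cv; rewrite !ddbarE -part11Z.
have Gt s : derivable ( *%R t : R -> R) s 1 by exact: derivableZ.
have G1 : ( *%R t : R -> R)^`()%classic = cst t.
  by apply/funext => s; rewrite derive1E deriveZ // derive_id [LHS]mulr1.
have G2 : (cst t : R -> R)^`()%classic = cst 0.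
  by apply/funext => s; rewrite derive1E derive_cst.
have CG : Ck1 2 ( *%R t : R -> R).
  split; first exact: Gt.
  rewrite G1; split=> [s|]; first exact: derivable_cst.
  by rewrite G2; exact: cst_continuous.
suff -> : d1 (delbar J (toC (fun y => t * v y))) x =
    real_complex R t *: d1 (delbar J (toC v)) x by [].
rewrite -[X in toC X]/( *%R t \o v) d1_delbar_comp // G1 G2.
by rewrite scale0r addr0.
Qed.

Section LeviForm.
Variable Y : 'rV[R[i]]_(n + n).
Hypothesis YJ : Y *m complexify (J x) = 'i%C *: Y.

Lemma proj01_trmxC : (proj01 (J x))^T *m Y ^t* = Y ^t*.
Proof.
have <- : (proj10 (J x)) ^t* = (proj01 (J x))^T.
  rewrite -conj_proj01; move: (proj01 (J x)) => Q.
  by apply/matrixP => i j; rewrite !mxE conjCK.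
by rewrite -trmxC_mul T10_proj10.
Qed.

(** Of the two terms of [part11] only [alpha(Y^{1,0}, (conj Y)^{0,1})] survives. *)
Lemma sform_part11 (alpha : 'M[R[i]]_(n + n)) :
  sform (part11 (J x) alpha) Y Y = sform alpha Y Y.
Proof.
have := proj01_trmxC; have := T10_proj10 YJ; have := T10_proj01 YJ.
rewrite /sform /part11; move: (proj10 (J x)) (proj01 (J x)) => P Q Y01 Y10 Y01'.
by rewrite mulmxDr mulmxDl !mulmxA Y10 Y01 !mul0mx addr0 -!mulmxA Y01'.
Qed.

(** The value of [dv /\ delbar v] on [(Y, conj Y)]: [delbar v] vanishes on [Y],
    and on [conj Y] it is the conjugate of [dv(Y)], [v] being real. *)
Lemma sform_d0_delbar v :
  sform (d0 (toC v) x *m (delbar J (toC v) x)^T -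
         delbar J (toC v) x *m (d0 (toC v) x)^T) Y Y =
  `|(Y *m d0 (toC v) x) 0 0| ^+ 2.
Proof.
have d0_real : (d0 (toC v) x)^T *m Y ^t* = (Y *m d0 (toC v) x) ^t*.
  rewrite trmxC_mul; congr (_ *m _); apply/matrixP => j c.
  by rewrite ord1 [LHS]mxE [RHS]mxE [X in X^*]mxE d0_toC conjC_real.
rewrite /sform mulmxBr mulmxBl /delbar /part01 trmx_mul !mulmxA T10_proj01 //.
rewrite !mul0mx subr0 -!mulmxA proj01_trmxC d0_real mulmxA.
by rewrite mxE big_ord1 normCK; congr (_ * _); rewrite [LHS]mxE [in LHS]mxE.
Qed.

Lemma sform_ddbar_comp (G : R -> R) v : Ck 2 U v -> Ck1 2 G ->
  sform (ddbar J (G \o v) x) Y Y =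
  real_complex R (G^`()%classic (v x)) * sform (ddbar J v x) Y Y +
  real_complex R (G^`()^`()%classic (v x)) * `|(Y *m d0 (toC v) x) 0 0| ^+ 2.
Proof.
move=> Cv CG; rewrite (ddbarE J (G \o v)) (ddbarE J v).
apply: (etrans (sform_part11 _)).
rewrite (d1_delbar_comp Cv CG) sformDm !sformZm sform_d0_delbar.
by rewrite -(sform_part11 (d1 (delbar J (toC v)) x)).
Qed.

End LeviForm.
End AtPoint.
End DdbarCalculus.

(** * Functions and Levi forms on a manifold *)

Section FunctionsInCharts.
Context {R : realType} {m : nat} {M : topologicalType}.
Variable X : smooth_manifold R m M.
Implicit Types (i : chart X) (U W : set M) (v w : M -> R) (p : M).

Lemma chart_image_open i U : open U -> open (coord i @` (dom i `&` U)).
Proof.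
move=> oU; rewrite openE => x [p [pi Up] px].
have xi : (coord i @` dom i) x by exists p.
have nUx : nbhs x (par i @^-1` U).
  apply: (par_continuous xi); rewrite -px coordK //.
  exact: open_nbhs_nbhs.
have ndx : nbhs x (coord i @` dom i).
  by apply: open_nbhs_nbhs; split=> //; exact: img_open.
apply: filterS2 nUx ndx => y Uy [q qi qy].
by exists q => //; split=> //; move: Uy; rewrite /= -qy coordK.
Qed.

Lemma C_on_infty k U v : C_on X Cinfty U v -> C_on X (Some k) U v.
Proof. by move=> Cv i; exact: Cv. Qed.

Lemma C_on_sub k U W v : U `<=` W -> C_on X (Some k) W v -> C_on X (Some k) U v.
Proof.
move=> UW Cv i; apply: Ck_sub (Cv i) => x [p [pi Up] <-].
by exists p => //; split=> //; exact: UW.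
Qed.

Lemma C_onU k U W v : C_on X (Some k) U v -> C_on X (Some k) W v ->
  C_on X (Some k) (U `|` W) v.
Proof.
move=> CU CW i; apply: Ck_sub (CkU (CU i) (CW i)) => x [p [pi [Up|Wp]] <-].
  by left; exists p.
by right; exists p.
Qed.

Lemma C_on_congr k U v w : open U -> (forall p, U p -> v p = w p) ->
  C_on X (Some k) U v -> C_on X (Some k) U w.
Proof.
move=> oU vw Cv i; apply: Ck_congr (Cv i); first exact: chart_image_open.
by move=> x [p [pi Up] <-] /=; rewrite coordK // vw.
Qed.

Lemma C_on_cst k U (c : R) : C_on X (Some k) U (cst c).
Proof. by move=> i; exact: Ck_cst. Qed.

Lemma C_onD k U v w : open U -> C_on X (Some k) U v -> C_on X (Some k) U w ->
  C_on X (Some k) U (fun p => v p + w p).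
Proof. by move=> oU Cv Cw i; exact: (CkD (@chart_image_open i _ oU) (Cv i) (Cw i)). Qed.

Lemma C_onM k U v w : open U -> C_on X (Some k) U v -> C_on X (Some k) U w ->
  C_on X (Some k) U (fun p => v p * w p).
Proof. by move=> oU Cv Cw i; exact: (CkM (@chart_image_open i _ oU) (Cv i) (Cw i)). Qed.

Lemma C_onZ k U (t : R) v : open U -> C_on X (Some k) U v ->
  C_on X (Some k) U (fun p => t * v p).
Proof. by move=> oU; apply: C_onM => //; exact: C_on_cst. Qed.

Lemma C_on_comp k U (G : R -> R) v : open U -> Ck1 k G -> C_on X (Some k) U v ->
  C_on X (Some k) U (G \o v).
Proof. by move=> oU CG Cv i; apply: (Ck_comp1 (@chart_image_open i _ oU) CG (Cv i)). Qed.

Lemma C_on_sum k U (I : Type) (r : seq I) (v : I -> M -> R) : open U ->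
  (forall j, C_on X (Some k) U (v j)) -> C_on X (Some k) U (fun p => \sum_(j <- r) v j p).
Proof.
move=> oU Cv i; apply: (Ck_sum r (@chart_image_open i _ oU)) => j; exact: Cv.
Qed.

Lemma C_on_continuous k U v p : open U -> C_on X (Some k) U v -> U p ->
  {for p, continuous v}.
Proof.
move=> oU Cv Up; have [i pi] := dom_cover X p.
have vE : \forall q \near p, ((v \o par i) \o coord i) q = v q.
  have : nbhs p (dom i) by apply: open_nbhs_nbhs; split=> //; exact: dom_open.
  by apply: filterS => q qi /=; rewrite coordK.
have cv : {for coord i p, continuous (v \o par i)}.
  by apply: (Ck_continuous (Cv i)); exists p.
have cvc : {for p, continuous ((v \o par i) \o coord i)}.
  by apply: continuous_comp cv; exact: coord_continuous.
suff : v q @[q --> p] --> v p by [].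
rewrite -{2}(coordK pi); apply: cvg_trans cvc.
by apply: near_eq_cvg.
Qed.

Lemma C_closureW Omega v : C_closure X Cinfty Omega v -> C_closure X C2 Omega v.
Proof.
by move=> [U [w [oU clU Cw vw]]]; exists U, w; split=> //; exact: C_on_infty.
Qed.

Lemma C_closure_on Omega v : open Omega -> C_closure X C2 Omega v ->
  C_on X C2 Omega v.
Proof.
move=> oO [U [w [oU clU Cw vw]]].
apply: (@C_on_congr _ _ w) => //.
  by move=> p Op; rewrite vw //; exact: subset_closure.
by apply: C_on_sub Cw => p Op; apply: clU; exact: subset_closure.
Qed.

Lemma C_closureD Omega v w : C_closure X C2 Omega v -> C_closure X C2 Omega w ->
  C_closure X C2 Omega (fun p => v p + w p).
Proof.
move=> [U [v' [oU clU Cv vv]]] [W [w' [oW clW Cw ww]]].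
have oUW := openI oU oW.
exists (U `&` W), (fun p => v' p + w' p); split=> //.
- by move=> p Op; split; [exact: clU|exact: clW].
- by apply: C_onD => //; [apply: C_on_sub Cv|apply: C_on_sub Cw] => p [].
- by move=> p Op; rewrite vv // ww.
Qed.

Lemma C_closure_comp Omega (G : R -> R) v : Ck1 2 G -> C_closure X C2 Omega v ->
  C_closure X C2 Omega (fun p => G (v p)).
Proof.
move=> CG [U [v' [oU clU Cv vv]]]; exists U, (G \o v'); split.
- exact: oU.
- exact: clU.
- exact: (C_on_comp oU CG Cv).
- by move=> p Op; rewrite vv.
Qed.

Lemma C_closure_global Omega v : C_on X C2 setT v -> C_closure X C2 Omega v.
Proof. by move=> Cv; exists setT, v; split=> //; exact: openT. Qed.

Lemma C_closure_near_continuous k Omega v p : closure Omega p ->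
  C_closure X (Some k) Omega v -> exists2 w : M -> R, {for p, continuous w} &
    forall q, closure Omega q -> v q = w q.
Proof.
move=> Op [U [w [oU clU Cw vw]]]; exists w => //.
by apply: (C_on_continuous oU Cw); exact: clU.
Qed.

End FunctionsInCharts.

Section LeviForm.
Context {R : realType} {n : nat} {M : topologicalType}.
Context {X : smooth_manifold R (n + n) M}.
Variable H : almost_hermitian X.
Implicit Types (i : chart X) (p : M) (U : set M) (v w : M -> R).
Implicit Type (Y : 'rV[R[i]]_(n + n)).

(** [(del delbar v)(Y, conj Y)] *)
Definition levi i v p Y : R[i] := sform (ddbar_at H i v p) Y Y.

(** [dv(Y)] *)
Definition diff_at i v p Y : R[i] :=
  (Y *m d0 (toC (v \o par i)) (coord i p)) 0 0.

Lemma unitary_frame_basis i p : dom i p -> exists E : 'M[R[i]]_(n, n + n),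
  unitary_frame_at H i p E /\ forall Y, T10_at H i p Y -> exists z, Y = z *m E.
Proof.
move=> pi; have [E [EJ Eg Espan]] := exists_unitary_frame
  (acs_square H pi) (metric_sym H pi) (@metric_pos _ _ _ _ H _ _ pi).
by exists E; split.
Qed.

Lemma levi_frame i v p (E : 'M[R[i]]_(n, n + n)) z :
  sform (complex_hessian H i v p E) z z = levi i v p (z *m E).
Proof. by rewrite /levi /sform /complex_hessian trmxC_mul !mulmxA. Qed.

(** Every (1,0) vector is a combination of the vectors of a unitary frame. *)
Lemma JpshP Omega v : Jpsh H Omega v <-> C_on X C2 Omega v /\
  forall p, Omega p -> forall i, dom i p -> forall Y, T10_at H i p Y ->
    0 <= levi i v p Y.
Proof.
split=> -[Cv pos]; split=> // p Op i pi.
  have [E [uE Espan]] := unitary_frame_basis pi.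
  by move=> Y /Espan[z ->]; rewrite -levi_frame; exact: pos uE z.
move=> E [EJ _] z.
change (0 <= sform (complex_hessian H i v p E) z z).
by rewrite levi_frame; apply: pos => //; rewrite /T10_at -mulmxA EJ scalemxAr.
Qed.

Section AtPoint.
Variables (U : set M) (p : M) (i : chart X) (Y : 'rV[R[i]]_(n + n)).
Hypotheses (oU : open U) (Up : U p) (pi : dom i p) (YT : T10_at H i p Y).
Let U' := coord i @` (dom i `&` U).
Let oU' : open U'. Proof. exact: chart_image_open. Qed.
Let U'x : U' (coord i p). Proof. by exists p. Qed.
Let CJ a b : Ck 1 U' (fun y => acs H i y a b).
Proof.
apply: Ck_sub (acs_smooth H i a b 1) => y [q [qi _] <-]; by exists q.
Qed.

Lemma leviD v w : C_on X C2 U v -> C_on X C2 U w ->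
  levi i (fun q => v q + w q) p Y = levi i v p Y + levi i w p Y.
Proof.
move=> Cv Cw; rewrite /levi -sformDm /ddbar_at.
by rewrite -(ddbarD oU' U'x CJ (Cv i) (Cw i)).
Qed.

Lemma leviZ v (t : R) : C_on X C2 U v ->
  levi i (fun q => t * v q) p Y = real_complex R t * levi i v p Y.
Proof.
move=> Cv; rewrite /levi -sformZm /ddbar_at.
by rewrite -(ddbarZ oU' U'x CJ t (Cv i)).
Qed.

Lemma levi_comp (G : R -> R) v : C_on X C2 U v -> Ck1 2 G ->
  levi i (G \o v) p Y =
  real_complex R (G^`()%classic (v p)) * levi i v p Y +
  real_complex R (G^`()^`()%classic (v p)) * `|diff_at i v p Y| ^+ 2.
Proof.
move=> Cv CG.
have := sform_ddbar_comp oU' U'x CJ YT (Cv i) CG.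
by rewrite /= coordK.
Qed.

End AtPoint.

End LeviForm.

(** * Extending functions out of a chart *)

Section Cutoff.
Context {R : realType} {m : nat} {M : topologicalType}.
Variable X : smooth_manifold R m M.
Hypothesis M_compact : compact [set: M].

Definition cutoff (t : R) : R := posX 3 (1 - posX 3 (t - 1)).

Lemma cutoff1 t : t <= 1 -> cutoff t = 1.
Proof.
move=> t1; rewrite /cutoff /posX (max_r (x := t - 1)) ?subr_le0 // expr0n subr0.
by rewrite max_l ?expr1n // ler01.
Qed.

Lemma cutoff0 t : 2 <= t -> cutoff t = 0.
Proof.
move=> t2; rewrite /cutoff /posX; have t1 : 1 <= t - 1 by rewrite lerBrDr.
rewrite (max_l (x := t - 1)); last exact: le_trans t1.
by rewrite max_r ?expr0n // subr_le0 exprn_ege1.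
Qed.

Lemma C_on_coord (i0 : chart X) b : C_on X C2 (dom i0) (fun p => coord i0 p 0 b).
Proof. by move=> i; exact: (transition_smooth i i0 b). Qed.

Lemma C_on_dist (i0 : chart X) (x0 : 'rV[R]_m) (K : R) :
  C_on X C2 (dom i0) (fun p => K * \sum_b (coord i0 p 0 b - x0 0 b) ^+ 2).
Proof.
have od := dom_open i0.
apply: (C_onZ K od); apply: (C_on_sum _ od) => b.
have Cb : C_on X C2 (dom i0) (fun p => coord i0 p 0 b + cst (- x0 0 b) p).
  apply: (C_onD od); [exact: C_on_coord | exact: C_on_cst].
exact: (C_onM od Cb Cb).
Qed.

(** Multiply by a cutoff supported in the chart; regularity of [M] keeps the
    support away from the points outside the chart. *)
Lemma C2_extension (i0 : chart X) p0 (f : M -> R) : dom i0 p0 ->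
  C_on X C2 (dom i0) f ->
  exists2 F : M -> R, C_on X C2 setT F & \forall p \near p0, F p = f p.
Proof.
move=> p0i Cf; have od := dom_open i0.
have nd : nbhs p0 (dom i0) by exact: open_nbhs_nbhs.
have [V Vp0 clV] : exists2 V, nbhs p0 V & closure V `<=` dom i0.
  have nT : nbhs p0 [set: M] by exact: filterT.
  exact: (compact_regular (mfd_hausdorff X) M_compact nT nd).
pose x0 := coord i0 p0.
have [r r0 rV] : exists2 r : R, 0 < r & ball x0 r `<=` par i0 @^-1` V.
  apply/nbhs_ballP; apply: (@par_continuous _ _ _ X i0 x0); first by exists p0.
  by rewrite /x0 coordK.
(* [q < 2] confines the coordinates to the ball of radius [r] around [x0] *)
pose K := 2 / r ^+ 2.
have K0 : 0 < K by rewrite divr_gt0 // exprn_gt0.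
pose q p := K * \sum_b (coord i0 p 0 b - x0 0 b) ^+ 2.
have qV p : dom i0 p -> q p < 2 -> V p.
  move=> pi qp; rewrite -(coordK pi); apply: rV; split=> // i b.
  rewrite ord1 /ball /= distrC -ltr_sqr ?nnegrE // ?(ltW r0) // real_normK ?num_real //.
  have : K * (coord i0 p 0 b - x0 0 b) ^+ 2 < 2.
    apply: le_lt_trans qp; rewrite ler_pM2l // (bigD1 b) //= lerDl.
    by apply: sumr_ge0 => c _; exact: sqr_ge0.
  by rewrite /K mulrAC ltr_pdivrMr ?exprn_gt0 // ltr_pM2l.
have Cq : C_on X C2 (dom i0) q by exact: C_on_dist.
have Cc : C_on X C2 (dom i0) (fun p => cutoff (q p) * f p).
  apply: (C_onM od _ Cf).
  have C1 : C_on X C2 (dom i0) (fun p => cst 1 p + -1 * posX 3 (q p + cst (-1) p)).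
    apply: (C_onD od); first exact: C_on_cst.
    apply: (C_onZ _ od).
    apply: (C_on_comp od posX3_Ck1 (v := fun p => q p + cst (-1) p)).
    by apply: (C_onD od Cq); exact: C_on_cst.
  apply: (C_on_congr od _ (C_on_comp od posX3_Ck1 C1)) => p _.
  by rewrite /cutoff /= mulN1r.
pose F p := if pselect (dom i0 p) then cutoff (q p) * f p else 0.
exists F.
  have oV : open (~` closure V) by apply: closed_openC; exact: closed_closure.
  have -> : [set: M] = dom i0 `|` ~` closure V.
    apply/seteqP; split=> // p _; have [pV|npV] := pselect (closure V p).
      by left; exact: clV.
    by right.
  apply: C_onU.
    apply: (C_on_congr od _ Cc) => p pi; rewrite /F.
    by case: pselect.
  apply: (C_on_congr oV _ (@C_on_cst R m M X 2 _ 0)) => p npV; rewrite /F /=.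
  case: pselect => // pi; rewrite cutoff0 ?mul0r // leNgt; apply/negP => /(qV _ pi) Vp.
  by apply: npV; exact: subset_closure.
have cq : {for p0, continuous q} by exact: C_on_continuous od Cq p0i.
have q0 : q p0 = 0.
  by rewrite /q big1 ?mulr0 // => b _; rewrite subrr expr0n.
have nq : \forall p \near p0, q p < 1.
  by apply: (cq [set t | t < 1]); apply: lt_nbhsl; rewrite q0.
apply: filterS2 nd nq => p pi qp; rewrite /F.
by case: pselect => // ?; rewrite cutoff1 ?mul1r // ltW.
Qed.

End Cutoff.

(** * The metric and the differentials of coordinates *)

Section Forms.
Context {R : realType} {N : nat}.

Lemma sform_entry_bound (g : 'M[R]_N) (B : R) (Y : 'rV[R[i]]_N) :
  (forall a b, `|g a b| <= B) ->
  `|sform (complexify g) Y Y| <=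
    real_complex R (B * (2 * N%:R)) * \sum_b `|Y 0 b| ^+ 2.
Proof.
move=> gB; set S := \sum_b _.
have prod_le a b : `|Y 0 a| * `|Y 0 b| <= `|Y 0 a| ^+ 2 + `|Y 0 b| ^+ 2.
  have [ab|ba] := real_leP (normr_real (Y 0 a)) (normr_real (Y 0 b)).
    by rewrite -[leLHS]add0r lerD ?exprn_ge0 // expr2 ler_wpM2r.
  by rewrite -[leLHS]addr0 lerD ?exprn_ge0 // expr2 ler_wpM2l // ltW.
have gBC a b : `|complexify g a b| <= real_complex R B.
  rewrite mxE normc_def /= expr0n addr0 sqrtr_sqr lecR; exact: gB.
have B0 (a b : 'I_N) : 0 <= real_complex R B by exact: (le_trans (normr_ge0 _) (gBC a b)).
have -> : real_complex R (B * (2 * N%:R)) * S =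
    \sum_b \sum_a real_complex R B * (`|Y 0 a| ^+ 2 + `|Y 0 b| ^+ 2).
  have -> : \sum_b \sum_a real_complex R B * (`|Y 0 a| ^+ 2 + `|Y 0 b| ^+ 2) =
      real_complex R B * \sum_b (S + N%:R * `|Y 0 b| ^+ 2).
    rewrite mulr_sumr; apply: eq_bigr => b _; rewrite -mulr_sumr big_split /=.
    by rewrite sumr_const card_ord mulr_natl.
  rewrite big_split /= sumr_const card_ord -mulr_sumr -/S -[S *+ N]mulr_natl -mulrDl.
  by rewrite !rmorphM /= !rmorph_nat -mulrA; congr (_ * (_ * _)); rewrite mulr_natl mulr2n.
rewrite /sform mxE; apply: le_trans (ler_norm_sum _ _ _) _; apply: ler_sum => b _.
rewrite normrM mxE; set T := (X in `|X| * _).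
have -> : `|((Y^T) ^ Num.conj)%sesqui b 0| = `|Y 0 b| by rewrite !mxE norm_conjC.
have TB : `|T| <= \sum_a real_complex R B * `|Y 0 a|.
  apply: le_trans (ler_norm_sum _ _ _) _; apply: ler_sum => a _.
  by rewrite normrM mulrC ler_wpM2r.
apply: le_trans (ler_wpM2r (normr_ge0 _) TB) _.
rewrite mulr_suml; apply: ler_sum => a _; rewrite -mulrA ler_wpM2l //.
exact: B0 a b.
Qed.

End Forms.

Section Chart.
Context {R : realType} {n : nat} {M : topologicalType}.
Context {X : smooth_manifold R (n + n) M}.
Variable H : almost_hermitian X.
Implicit Types (i : chart X) (p : M).

Lemma metric_form_ge0 i p Y : dom i p ->
  0 <= sform (complexify (metric_at H i p)) Y Y.
Proof.
move=> pi; have [->|Y0] := eqVneq Y 0.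
  by rewrite /sform !mul0mx mxE.
exact/ltW/(metric_herm_pos (metric_sym H pi) (@metric_pos _ _ _ _ H _ _ pi)).
Qed.

Lemma metric_form_bound i0 p0 : dom i0 p0 -> exists2 C : R, 0 < C &
  \forall p \near p0, dom i0 p -> forall Y,
    sform (complexify (metric_at H i0 p)) Y Y <=
    real_complex R C * \sum_b `|Y 0 b| ^+ 2.
Proof.
move=> p0i.
pose g0 := metric_at H i0 p0.
pose B := 1 + \sum_(ab : 'I_(n + n) * 'I_(n + n)) `|g0 ab.1 ab.2|.
have S0 : 0 <= \sum_(ab : 'I_(n + n) * 'I_(n + n)) `|g0 ab.1 ab.2| by exact: sumr_ge0.
have B0 : 0 < B by rewrite ltr_pwDl.
exists (B * (2 * (n + n)%:R) + 1); first by rewrite ltr_wpDl // !mulr_ge0 // ltW.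
have nB : \forall p \near p0, forall ab : 'I_(n + n) * 'I_(n + n),
    `|metric_at H i0 p ab.1 ab.2| <= B.
  apply: filter_forall => -[a b] /=.
  have cg : {for p0, continuous (fun p => metric_at H i0 p a b)}.
    apply: (@continuous_comp _ _ _ (coord i0) (fun x => metric H i0 x a b)).
      exact: coord_continuous.
    by apply: (metric_smooth H i0 a b 0); exists p0.
  have lt0 : `|g0 a b| < B.
    rewrite ltr_pwDl // (bigD1 (a, b)) //= lerDl; exact: sumr_ge0.
  have cn : {for p0, continuous (fun p => `|metric_at H i0 p a b|)}.
    by apply: (continuous_comp cg); exact: norm_continuous.
  have := cn [set t | t < B]; rewrite /nbhs /= => /(_ (lt_nbhsl lt0)).
  by apply: filterS => p /ltW.
apply: filterS nB => p nB pi Y.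
rewrite -(ger0_norm (metric_form_ge0 Y pi)).
apply: le_trans (sform_entry_bound (B := B) _ _) _.
  by move=> a b; exact: (nB (a, b)).
rewrite ler_wpM2r ?lecR ?lerDl //.
by apply: sumr_ge0 => b _; exact: exprn_ge0.
Qed.

(** [F] is a coordinate of chart [i0] up to a constant, and the differentials of
    the coordinates of [i0] give the components of a vector in [i0]. *)
Lemma diff_at_coord i i0 p (F : M -> R) (c : R) b Y : dom i p -> dom i0 p ->
  (\forall q \near p, F q = coord i0 q 0 b - c) ->
  diff_at i F p Y = (Y *m complexify (jac_change i i0 p)) 0 b.
Proof.
move=> pi p0 FE.
pose T x := coord i0 (par i x).
have Tb b' : differentiable (fun x => T x 0 b') (coord i p).
  apply: (Ck_differentiable (transition_smooth i i0 b' 1)); by exists p.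
have dT : differentiable T (coord i p).
  have -> : T = \sum_b' (fun x => T x 0 b' *: delta_mx 0 b').
    by apply/funext => x; rewrite fct_sumE -row_sum_delta.
  by apply: differentiable_sum => b'; exact: differentiableZl.
rewrite /diff_at mxE [RHS]mxE; apply: eq_bigr => a _; congr (_ * _).
rewrite d0_toC mxE; congr (real_complex R _).
have -> : jac_change i i0 p a b = ('D_(delta_mx 0 a) T (coord i p)) 0 b.
  by rewrite deriveEjacobian // -rowE [RHS]mxE.
rewrite derive_mx ?mxE; last exact: diff_derivable.
have nx : \forall x \near coord i p, (F \o par i) x = T x 0 b + cst (- c) x.
  have xi : (coord i @` dom i) (coord i p) by exists p.
  have pc : par i x @[x --> coord i p] --> p.
    by rewrite -{2}(coordK pi); exact: par_continuous.
  exact: (pc [set q | F q = coord i0 q 0 b - c]).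
rewrite (near_eq_derive _ nx) deriveD ?derive_cst ?addr0 //.
exact: diff_derivable.
Qed.

End Chart.

(** * Uniform strict plurisubharmonicity *)

Section UniformBound.
Context {R : realType} {n : nat} {M : topologicalType}.
Context {X : smooth_manifold R (n + n) M}.
Variable H : almost_hermitian X.
Implicit Types (i : chart X) (p : M) (U : set M) (v w : M -> R).
Implicit Type (Y : 'rV[R[i]]_(n + n)).

Lemma Ck1_sqr : Ck1 2 (fun t : R => t ^+ 2) /\
  (fun t : R => t ^+ 2)^`()%classic = (fun t => 2 * t) /\
  (fun t : R => 2 * t)^`()%classic = cst 2.
Proof.
have G1 : (fun t : R => t ^+ 2)^`()%classic = (fun t => 2 * t).
  by apply/funext => t; rewrite exp_derive1 expr1.
have G2 : (fun t : R => 2 * t)^`()%classic = cst 2.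
  by apply/funext => t; rewrite derive1E deriveZ // derive_id [LHS]mulr1.
split=> //; split=> [t|]; first exact: exprn_derivable.
rewrite G1; split=> [t|]; first exact: derivableZ.
by rewrite G2; exact: cst_continuous.
Qed.

Section AtPoint.
Variables (U : set M) (p : M) (i : chart X) (Y : 'rV[R[i]]_(n + n)).
Hypotheses (oU : open U) (Up : U p) (pi : dom i p) (YT : T10_at H i p Y).

Lemma levi_cst0 : levi H i (cst 0) p Y = 0.
Proof.
have -> : cst 0 = (fun q : M => 0 * cst 0 q) :> (M -> R).
  by apply/funext => q; rewrite mul0r.
by rewrite (leviZ H Y oU Up pi 0 (C_on_cst (X := X) 2 U 0)) mul0r.
Qed.

Lemma levi_sum (I : Type) (r : seq I) (v : I -> M -> R) :
  (forall j, C_on X C2 U (v j)) ->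
  levi H i (fun q => \sum_(j <- r) v j q) p Y = \sum_(j <- r) levi H i (v j) p Y.
Proof.
move=> Cv; elim: r => [|j r IH].
  rewrite big_nil -levi_cst0; congr (levi H i _ p Y).
  by apply/funext => q; rewrite big_nil.
rewrite big_cons -IH -(leviD H Y oU Up pi (Cv j) (C_on_sum r oU Cv)).
by congr (levi H i _ p Y); apply/funext => q; rewrite big_cons.
Qed.

Lemma levi_sqr v : C_on X C2 U v -> levi H i (fun q => v q ^+ 2) p Y =
  real_complex R (2 * v p) * levi H i v p Y + 2 * `|diff_at i v p Y| ^+ 2.
Proof.
move=> Cv; have [CG [G1 G2]] := Ck1_sqr.
have := levi_comp oU Up pi YT Cv CG; rewrite G1 G2 => ->.
by rewrite /= rmorph_nat.
Qed.

End AtPoint.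

Hypothesis M_compact : compact [set: M].
Variable Omega : set M.
Hypothesis oO : open Omega.
Variable rho : M -> R.
Hypothesis rho_spsh : strictly_Jpsh H Omega rho.

Lemma spsh_C2 : C_on X C2 Omega rho.
Proof. by apply: C_closure_on => //; case: rho_spsh. Qed.

(** Strictness as a filter statement, so that finitely many test functions can
    share one [e]. *)
Lemma spsh_near psi : C_closure X C2 Omega psi ->
  \forall e \near 0^'+, forall p, Omega p -> forall i, dom i p ->
    forall Y, T10_at H i p Y ->
    0 <= levi H i rho p Y + real_complex R e * levi H i psi p Y.
Proof.
move=> Cpsi; case: rho_spsh => _ /(_ psi Cpsi)[e0 e00 He].
near=> e => p Op i pi Y YT.
have e1 : 0 < e by near: e; exact: nbhs_right_gt.
have e2 : e < e0 by near: e; exact: nbhs_right_lt.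
have CO := C_closure_on oO Cpsi.
have /JpshP[_ /(_ p Op i pi Y YT)] := He e e1 e2.
by rewrite (leviD H Y oO Op pi spsh_C2 (C_onZ e oO CO)) (leviZ H Y oO Op pi e CO).
Unshelve. all: by end_near. Qed.

Lemma spsh_ge0 p i Y : Omega p -> dom i p -> T10_at H i p Y -> 0 <= levi H i rho p Y.
Proof.
move=> Op pi YT.
have C0 : C_closure X C2 Omega (cst 0) by exact: C_closure_global (C_on_cst _ _ _).
have /filter_ex[e /(_ p Op i pi Y YT)] := spsh_near C0.
by rewrite (levi_cst0 Y oO Op pi) mulr0 addr0.
Qed.

(** Near [p0], with [F_b] global functions equal to the centred coordinates,
    strictness bounds the Levi form [L] of [rho] below by [e] times that of
    [- F_b], [F_b] and [\sum_b F_b ^+ 2]. As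
    [L (F_b ^+ 2) = 2 F_b L F_b + 2 |d F_b (Y)|^2] and [F_b] is small near
    [p0], this gives [L >= e |Y|^2] for the Euclidean norm of the chart at
    [p0], in whichever chart [Y] is read. *)
Lemma spsh_local_bound p0 :
  \forall p \near p0 & t \near 0^'+, Omega p -> forall i, dom i p ->
    forall Y, T10_at H i p Y ->
    real_complex R t * sform (complexify (metric_at H i p)) Y Y <= levi H i rho p Y.
Proof.
have [i0 p0i] := dom_cover X p0; have od := dom_open i0.
pose f b p := coord i0 p 0 b - coord i0 p0 0 b.
have Cf b : C_on X C2 (dom i0) (f b).
  by apply: (C_onD od); [exact: C_on_coord | exact: C_on_cst].
have [F CF Ff] : exists2 F : 'I_(n + n) -> M -> R, (forall b, C_on X C2 setT (F b)) &
    forall b, \forall p \near p0, F b p = f b p.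
  have ext b := C2_extension M_compact p0i (Cf b).
  by exists (fun b => s2val (cid2 (ext b))) => b; case: cid2.
pose Q p := \sum_b F b p ^+ 2.
have oT : open [set: M] by exact: openT.
have CQ : C_on X C2 setT Q.
  by apply: (C_on_sum _ oT) => b; exact: (C_onM oT (CF b) (CF b)).
(* one [e] for the finitely many test functions *)
have [e [e0 He]] : exists e : R, 0 < e /\ forall p, Omega p -> forall i, dom i p ->
    forall Y, T10_at H i p Y ->
    [/\ forall b, 0 <= levi H i rho p Y + real_complex R e * levi H i (F b) p Y,
        forall b, 0 <= levi H i rho p Y - real_complex R e * levi H i (F b) p Y &
        0 <= levi H i rho p Y - real_complex R e * levi H i Q p Y].
  pose A psi e := forall p, Omega p -> forall i, dom i p ->
    forall Y, T10_at H i p Y ->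
    0 <= levi H i rho p Y + real_complex R e * levi H i psi p Y.
  have AN psi e : C_on X C2 setT psi -> A (fun q => -1 * psi q) e ->
      forall p, Omega p -> forall i, dom i p -> forall Y, T10_at H i p Y ->
      0 <= levi H i rho p Y - real_complex R e * levi H i psi p Y.
    move=> Cpsi Ae p Op i pi Y YT; have := Ae p Op i pi Y YT.
    by rewrite (leviZ H Y oT I pi (-1) Cpsi) rmorphN1 mulN1r mulrN.
  have near1 : \forall e \near 0^'+, forall b, A (F b) e.
    by apply: filter_forall => b; exact: spsh_near (C_closure_global Omega (CF b)).
  have near2 : \forall e \near 0^'+, forall b, A (fun q => -1 * F b q) e.
    apply: filter_forall => b.
    exact: spsh_near (C_closure_global Omega (C_onZ (-1) oT (CF b))).
  have near3 : \forall e \near 0^'+, A (fun q => -1 * Q q) e.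
    exact: spsh_near (C_closure_global Omega (C_onZ (-1) oT CQ)).
  have near0 : \forall e \near (0 : R)^'+, 0 < e by exact: nbhs_right_gt.
  have [e [[[e0 A1] A2] A3]] :=
    filter_ex (filterI (filterI (filterI near0 near1) near2) near3).
  exists e; split=> // p Op i pi Y YT; split=> [b|b|].
  - exact: (A1 b p Op i pi Y YT).
  - exact: (AN _ _ (CF b) (A2 b) p Op i pi Y YT).
  - exact: (AN _ _ CQ A3 p Op i pi Y YT).
have [C C0 gC] := metric_form_bound H p0i.
(* [d] is such that the sum over [b] of [2 d L] is at most [L] *)
pose d : R := (2 * (n + n).+1%:R)^-1.
have d0 : 0 < d by rewrite invr_gt0 mulr_gt0.
have Fsmall : \forall p \near p0, forall b, `|F b p| < d.
  apply: filter_forall => b.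
  have Fb0 : F b p0 = 0 by rewrite (nbhs_singleton (Ff b)) /f subrr.
  have cF : {for p0, continuous (fun p => `|F b p|)}.
    apply: (@continuous_comp _ _ _ (F b) Num.norm); last exact: norm_continuous.
    exact: (C_on_continuous oT (CF b) I).
  by apply: (cF [set t | t < d]); apply: lt_nbhsl; rewrite Fb0 normr0.
have Fcoord : \forall p \near p0, forall b, \forall q \near p, F b q = f b q.
  by apply: filter_forall => b; exact: near_join.
have nd : nbhs p0 (dom i0) by exact: open_nbhs_nbhs.
near=> p t => Op i pi Y YT.
have p_i0 : dom i0 p by near: p.
have [HF HF' HQ] := He p Op i pi Y YT.
set L := levi H i rho p Y in HF HF' HQ *.
have L0 : 0 <= L by exact: spsh_ge0.
have t0 : 0 < t by near: t; exact: nbhs_right_gt.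
have tC : t * C <= e.
  rewrite -ler_pdivlMr // ltW //; near: t; apply: nbhs_right_lt.
  exact: divr_gt0.
have gradE b : diff_at i (F b) p Y = (Y *m complexify (jac_change i i0 p)) 0 b.
  apply: (@diff_at_coord _ _ _ _ i i0 p (F b) (coord i0 p0 0 b) b Y pi p_i0).
  by move: b; near: p; exact: Fcoord.
set Z := Y *m complexify (jac_change i i0 p) in gradE.
have LQ : levi H i Q p Y = \sum_b (real_complex R (2 * F b p) * levi H i (F b) p Y +
    2 * `|Z 0 b| ^+ 2).
  rewrite (levi_sum Y oT I pi _ (fun b => C_onM oT (CF b) (CF b))).
  by apply: eq_bigr => b _; rewrite -gradE -(levi_sqr oT I pi YT (CF b)).
have mixed b : - (real_complex R e * (real_complex R (2 * F b p) * levi H i (F b) p Y)) <=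
    real_complex R (2 * d) * L.
  rewrite mulrCA; have := HF b; have := HF' b.
  move: (real_complex R e * levi H i (F b) p Y) => z z1 z2.
  have zr : z \is Num.real.
    have /realB := ger0_real z2 => /(_ _ (ger0_real L0)).
    by rewrite addrC addKr.
  have zL : `|z| <= L.
    rewrite real_ler_norml //; apply/andP.
    by split; rewrite -subr_ge0 ?opprK // addrC.
  have Fr : real_complex R (2 * F b p) \is Num.real by rewrite complex_real.
  apply: le_trans (real_ler_norm _) _; first by rewrite realN realM.
  rewrite normrN normrM ler_pM //.
  rewrite normc_def /= expr0n addr0 sqrtr_sqr lecR normrM ger0_norm //.
  by rewrite ler_pM2l // ltW //; move: b {z1 z2 zr zL Fr}; near: p.
have grad_le : real_complex R e * \sum_b `|Z 0 b| ^+ 2 <= L.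
  have S0 : \sum_(b < n + n) real_complex R (2 * d) * L <= L.
    rewrite sumr_const card_ord -[_ *+ (n + n)]mulr_natl mulrA -[leRHS]mul1r ler_wpM2r //.
    rewrite -(rmorph_nat (real_complex R)) -rmorphM (lecR _ 1) /d.
    rewrite mulrA ler_pdivrMr ?mulr_gt0 // mul1r mulrC ler_pM2l //.
    by rewrite ler_nat leqnSn.
  have : 2 * (real_complex R e * \sum_b `|Z 0 b| ^+ 2) <= L + L.
    move: HQ; rewrite LQ big_split /= mulrDr opprD addrA subr_ge0 -mulr_sumr mulrCA.
    move=> /le_trans; apply; rewrite lerD2l -mulrN -sumrN mulr_sumr.
    apply: le_trans S0; apply: ler_sum => b _.
    by rewrite mulrN mixed.
  by rewrite -[L + L]mulr2n -[L *+ 2]mulr_natl ler_pM2l.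
have gE : sform (complexify (metric_at H i p)) Y Y =
    sform (complexify (metric_at H i0 p)) Z Z.
  rewrite /metric_at (metric_change H pi p_i0) /sform !complexifyM /Z trmxC_mul.
  by rewrite complexify_tr complexify_conj !mulmxA.
have gZ : sform (complexify (metric_at H i0 p)) Z Z <=
    real_complex R C * \sum_b `|Z 0 b| ^+ 2.
  by apply: (near gC p).
rewrite gE; apply: le_trans grad_le.
apply: le_trans (ler_wpM2l _ gZ) _; first by rewrite ler0c ltW.
rewrite mulrA -rmorphM ler_wpM2r ?lecR //.
by apply: sumr_ge0 => b _; exact: exprn_ge0.
Unshelve. all: by end_near. Qed.

Lemma closure_compact : compact (closure Omega).
Proof. exact: subclosed_compact (@closed_closure _ _) M_compact _. Qed.

(** The local bounds near finitely many points of the compact closure. *)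
Lemma spsh_uniform : exists2 t : R, 0 < t &
  forall p, Omega p -> forall i, dom i p -> forall Y, T10_at H i p Y ->
    real_complex R t * sform (complexify (metric_at H i p)) Y Y <= levi H i rho p Y.
Proof.
pose P (t : R) p := Omega p -> forall i, dom i p -> forall Y, T10_at H i p Y ->
  real_complex R t * sform (complexify (metric_at H i p)) Y Y <= levi H i rho p Y.
have cov := (compact_near_coveringP _).1 closure_compact _ _ P
  (at_right_proper_filter (0 : R)) (fun p _ => spsh_local_bound p).
have t_gt0 : \forall t \near (0 : R)^'+, 0 < t by exact: nbhs_right_gt.
have [t [t0 Pt]] := filter_ex (filterI t_gt0 cov).
exists t => // p Op; apply: Pt => //; exact: subset_closure.
Qed.

Lemma closure_lower_bound (f : M -> R) :
  C_closure X C2 Omega f -> (forall p, closure Omega p -> 0 < f p) ->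
  exists2 t : R, 0 < t & forall p, closure Omega p -> t <= f p.
Proof.
move=> Cf f0; pose P (t : R) p := closure Omega p -> t <= f p.
have loc p : closure Omega p -> \forall q \near p & t \near 0^'+, P t q.
  move=> Op; have [w cw fw] := C_closure_near_continuous Op Cf.
  have wp : 0 < w p by rewrite -fw ?f0.
  have w2 : w p / 2 < w p by rewrite ltr_pdivrMr // ltr_pMr // ltr1n.
  have nw : \forall q \near p, w p / 2 < w q.
    by apply: (cw [set t | w p / 2 < t]); exact: lt_nbhsr.
  near=> q t; have wq : w p / 2 < w q by near: q.
  have tw : t < w p / 2 by near: t; apply: nbhs_right_lt; exact: divr_gt0.
  by move=> Oq; rewrite fw // (le_trans (ltW tw)) // ltW.
have cov := (compact_near_coveringP _).1 closure_compact _ _ P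
  (at_right_proper_filter (0 : R)) loc.
have t_gt0 : \forall t \near (0 : R)^'+, 0 < t by exact: nbhs_right_gt.
have [t [t0 Pt]] := filter_ex (filterI t_gt0 cov).
by exists t => // p Op; apply: Pt.
Unshelve. all: by end_near. Qed.

End UniformBound.

(** * The subsolution *)

Section Subsolution.
Context {R : realType} {n : nat} {M : topologicalType}.
Context {X : smooth_manifold R (n + n) M}.
Variable H : almost_hermitian X.
Implicit Types (i : chart X) (p : M) (v w : M -> R).
Implicit Type (Y : 'rV[R[i]]_(n + n)).
Hypothesis n_gt0 : (0 < n)%N.
Hypothesis M_compact : compact [set: M].
Variable Omega : set M.
Hypothesis oO : open Omega.

Lemma d1_antisym (beta : 'rV[R]_(n + n) -> 'cV[R[i]]_(n + n)) x :
  (d1 beta x)^T = - d1 beta x.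
Proof. by apply/matrixP => a b; rewrite mxE [RHS]mxE !d1E opprB. Qed.

(** The eigenvalues of the complex Hessian in a unitary frame are at least
    [K], so the ratio of volume forms, its determinant, is at least [K ^+ n]. *)
Lemma wedge_power_ge i p v (K : R) : dom i p -> 1 <= K ->
  (forall Y, T10_at H i p Y ->
    real_complex R K * sform (complexify (metric_at H i p)) Y Y <= levi H i v p Y) ->
  exists2 c : R, K <= c &
    wedge_power ('i%C *: ddbar_at H i v p) =
    real_complex R c * wedge_power (kahler_at H i p).
Proof.
move=> pi K1 Kle; have [E [[EJ Eg] _]] := unitary_frame_basis H pi.
have K0 : 0 <= K by exact: le_trans K1.
have hess_ge z : real_complex R K * sform 1%:M z z <=
    sform (complex_hessian H i v p E) z z.
  have zE : T10_at H i p (z *m E) by rewrite /T10_at -mulmxA EJ scalemxAr.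
  rewrite levi_frame; apply: le_trans (Kle _ zE); rewrite ler_wpM2l ?ler0c //.
  by rewrite /sform trmxC_mul -Eg !mulmxA.
have detK : real_complex R (K ^+ n) <= \det (complex_hessian H i v p E).
  by rewrite rmorphXn; apply: det_ge => //; rewrite ler0c.
have ratio := wedge_power_ratio (acs_square H pi) (metric_acs H pi)
  (metric_sym H pi) EJ Eg
  (d1_antisym (delbar (acs H i) (toC (v \o par i))) (coord i p)).
move: detK; rewrite lecE /= => /andP[/eqP im_det re_det].
exists (complex.Re (\det (complex_hessian H i v p E))).
  exact: le_trans (ler_weXn2l K1 n_gt0) re_det.
apply: (etrans ratio); congr (_ * _).
by rewrite [LHS]complexE im_det rmorph0 mulr0 addr0.
Qed.

Variable rho : M -> R.
Hypothesis rho_spsh : strictly_Jpsh H Omega rho.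

Definition expB1 (t : R) : R := expR t - 1.

Lemma expB1_derive : (expB1^`()%classic = expR) /\ Ck1 2 expB1.
Proof.
have dE t : derivable expB1 t 1.
  by apply: derivableB; [exact: derivable_expR | exact: derivable_cst].
have G1 : expB1^`()%classic = expR.
  apply/funext => t; rewrite derive1E deriveB; [|exact: derivable_expR|exact: derivable_cst].
  by rewrite derive_cst subr0 -derive1E derive1_expR.
split; first exact: G1.
by split; [exact: dE | rewrite G1; exact: (Ck1_expR 1)].
Qed.

Section Candidate.
Variables (phihat : M -> R) (s : R).
Hypotheses (Cphihat : C_closure X C2 Omega phihat) (phihat_psh : Jpsh H Omega phihat).
Hypothesis s_gt0 : 0 < s.
Let u p := phihat p + s * (expR (rho p) - 1).

Lemma candidate_C2 : C_closure X C2 Omega u.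
Proof.
have [Crho _] := rho_spsh; apply: C_closureD => //.
apply: (C_closure_comp (G := fun t => s * expB1 t)) Crho.
by apply: Ck1Z; case: expB1_derive.
Qed.

Lemma levi_candidate p i Y : Omega p -> dom i p -> T10_at H i p Y ->
  levi H i u p Y = levi H i phihat p Y +
    real_complex R (s * expR (rho p)) * (levi H i rho p Y + `|diff_at i rho p Y| ^+ 2).
Proof.
move=> Op pi YT; have [G1 CG] := expB1_derive.
have Crho := spsh_C2 oO rho_spsh; have Cphi := C_closure_on oO Cphihat.
have CGrho := C_on_comp oO CG Crho.
have := leviD H Y oO Op pi Cphi (C_onZ s oO CGrho).
rewrite (leviZ H Y oO Op pi s CGrho) (levi_comp oO Op pi YT Crho CG) G1 => uE.
apply: (etrans uE); rewrite derive1_expR.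
by rewrite -mulrDr mulrA -rmorphM.
Qed.

Lemma levi_candidate_ge p i Y : Omega p -> dom i p -> T10_at H i p Y ->
  real_complex R (s * expR (rho p)) * levi H i rho p Y <= levi H i u p Y.
Proof.
move=> Op pi YT; rewrite levi_candidate // mulrDr addrCA lerDl.
have [_ /(_ p Op i pi Y YT) phi0] := (JpshP H Omega phihat).1 phihat_psh.
by rewrite addr_ge0 // mulr_ge0 ?exprn_ge0 // ler0c mulr_ge0 ?expR_ge0 // ltW.
Qed.

(** Adding [e psi] to [u] adds [e / (s exp rho)] times [psi] to [rho] inside
    [s exp(rho) L rho]; the quotient is admissible for all points at once since
    [exp rho] is bounded below by [m]. *)
Lemma candidate_spsh : strictly_Jpsh H Omega u.
Proof.
split; first exact: candidate_C2.
have [Crho rhoP] := rho_spsh.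
move=> psi Cpsi; have [e0 e00 He] := rhoP psi Cpsi.
have [m m0 mrho] := closure_lower_bound M_compact
  (C_closure_comp (Ck1_expR 2) Crho) (fun p _ => expR_gt0 (rho p)).
exists (e0 * (s * m)); first by rewrite !mulr_gt0.
move=> e e_gt0 e_lt; have Cu := C_closure_on oO candidate_C2.
have CO := C_closure_on oO Cpsi.
apply/JpshP; split; first exact: (C_onD oO Cu (C_onZ e oO CO)).
move=> p Op i pi Y YT.
rewrite (leviD H Y oO Op pi Cu (C_onZ e oO CO)) (leviZ H Y oO Op pi e CO).
set k := s * expR (rho p); have k0 : 0 < k by rewrite mulr_gt0 ?expR_gt0.
have ek_lt : e / k < e0.
  rewrite ltr_pdivrMr //; apply: lt_le_trans e_lt _.
  by rewrite ler_pM2l // ler_pM2l // mrho //; exact: subset_closure.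
have ek_gt0 : 0 < e / k by exact: divr_gt0.
have [_ /(_ p Op i pi Y YT)] := (JpshP H Omega _).1 (He _ ek_gt0 ek_lt).
rewrite (leviD H Y oO Op pi (spsh_C2 oO rho_spsh) (C_onZ _ oO CO)).
rewrite (leviZ H Y oO Op pi _ CO) => ge0.
apply: le_trans (lerD (levi_candidate_ge Op pi YT) (lexx _)).
have -> : real_complex R e = real_complex R k * real_complex R (e / k).
  by rewrite -rmorphM mulrC divfK // gt_eqF.
by rewrite -/k -mulrA -mulrDr mulr_ge0 // ler0c ltW.
Qed.

End Candidate.

(** With [t] from the uniform bound, [exp rho >= m] and [exp (- h) >= c] on the
    closure, the eigenvalues of the complex Hessian are at least [s m t], and [s]
    is taken so large that this exceeds [1 + 1 / c >= exp h]. *)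
Lemma candidate_subsolution (h phi phihat : M -> R) :
  (forall p, bdry Omega p -> rho p = 0) -> C_closure X Cinfty Omega h ->
  C_closure X C2 Omega phihat -> Jpsh H Omega phihat ->
  (forall p, bdry Omega p -> phihat p = phi p) ->
  exists2 s0 : R, 0 < s0 & forall s : R, s0 <= s ->
    strictly_Jpsh_subsolution H Omega h phi
      (fun p => phihat p + s * (expR (rho p) - 1)).
Proof.
move=> rho0 Ch Cphihat phihat_psh phihatE; have [Crho _] := rho_spsh.
have [t t0 rho_ge] := spsh_uniform M_compact oO rho_spsh.
have [m m0 mrho] := closure_lower_bound M_compact
  (C_closure_comp (Ck1_expR 2) Crho) (fun p _ => expR_gt0 (rho p)).
have Cexph : C_closure X C2 Omega (fun p => expR (-1 * h p)).
  apply: (C_closure_comp (Ck1_expR 2)).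
  apply: (C_closure_comp (G := fun t => -1 * t)); last exact: C_closureW.
  exact: (@Ck1Z _ 2 _ id Ck1_id).
have [c c0 ch] := closure_lower_bound M_compact Cexph (fun p _ => expR_gt0 _).
exists ((1 + c^-1) / (m * t)); first by rewrite divr_gt0 ?mulr_gt0 // addr_gt0 // invr_gt0.
move=> s s0s; have s0 : 0 < s.
  by apply: lt_le_trans s0s; rewrite divr_gt0 ?mulr_gt0 // addr_gt0 // invr_gt0.
have Kbig : 1 + c^-1 <= s * (m * t) by rewrite -ler_pdivrMr // mulr_gt0.
split.
- exact: candidate_C2.
- exact: candidate_spsh.
- move=> p Op i pi; have Op' : closure Omega p by exact: subset_closure.
  have K1 : 1 <= s * (m * t) by apply: le_trans Kbig; rewrite lerDl invr_ge0 ltW.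
  have Kge Y : T10_at H i p Y ->
      real_complex R (s * (m * t)) * sform (complexify (metric_at H i p)) Y Y <=
      levi H i (fun q => phihat q + s * (expR (rho q) - 1)) p Y.
    move=> YT; apply: le_trans (levi_candidate_ge Cphihat phihat_psh s0 Op pi YT).
    have sE : 0 <= real_complex R (s * expR (rho p)).
      by rewrite ler0c mulr_ge0 ?expR_ge0 // ltW.
    apply: le_trans (ler_wpM2l sE (rho_ge p Op i pi Y YT)).
    rewrite [leRHS]mulrA -rmorphM ler_wpM2r ?metric_form_ge0 // lecR -mulrA ler_pM2l //.
    by rewrite ler_pM2r // mrho.
  have [k kK kE] := wedge_power_ge pi K1 Kge.
  exists k => //; apply: le_trans kK; apply: le_trans Kbig.
  have := ch p Op'; rewrite mulN1r expRN => chp.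
  rewrite -[leLHS]invrK; apply: (@le_trans _ _ c^-1); last by rewrite lerDr.
  by rewrite lef_pV2 // posrE // invr_gt0 expR_gt0.
- by move=> p bp; rewrite rho0 // expR0 subrr mulr0 addr0 phihatE.
Qed.

End Subsolution.

Theorem mainTheorem2 (R : realType) (n : nat) (n_gt0 : (0 < n)%N)
    (M : topologicalType) (X : smooth_manifold R (n + n) M)
    (H : almost_hermitian X) (M_compact : compact [set: M])
    (Omega : set M) (Omega_psc : smooth_pseudoconvex_domain H Omega)
    (rho : M -> R) (rho_def : defining_function X Omega rho)
    (rho_spsh : strictly_Jpsh H Omega rho)
    (phi h : M -> R)
    (phi_smooth : C_closure X Cinfty Omega phi)
    (h_smooth : C_closure X Cinfty Omega h) :
  (exists u : M -> R, strictly_Jpsh_subsolution H Omega h phi u) /\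
  (forall phihat : M -> R,
     C_closure X C2 Omega phihat -> Jpsh H Omega phihat ->
     (forall p, bdry Omega p -> phihat p = phi p) ->
     exists2 s0 : R, 0 < s0 &
       forall s : R, s0 <= s ->
         strictly_Jpsh_subsolution H Omega h phi
           (fun p => phihat p + s * (expR (rho p) - 1))).
Proof.
have oO : open Omega by case: Omega_psc => -[].
have rho0 : forall p, bdry Omega p -> rho p = 0 by case: rho_def.
have sub phihat := @candidate_subsolution _ _ _ _ H n_gt0 M_compact Omega oO rho
  rho_spsh h phi phihat rho0 h_smooth.
split=> //; have Cphi := C_closureW phi_smooth.
have [Crho /(_ phi Cphi)[e0 e00 He]] := rho_spsh.
(* [phi + rho / e] is [1 / e] times [rho + e phi], which is admissible for
   [e < e0] *)
pose e := e0 / 2; have e_gt0 : 0 < e by exact: divr_gt0.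
have e_lt : e < e0 by rewrite ltr_pdivrMr // ltr_pMr // ltr1n.
have Cp : C_closure X C2 Omega (fun p => phi p + e^-1 * rho p).
  apply: C_closureD => //; apply: (C_closure_comp (G := fun t => e^-1 * t)) Crho.
  exact: (@Ck1Z _ 2 _ id Ck1_id).
have Jp : Jpsh H Omega (fun p => phi p + e^-1 * rho p).
  have Co := C_closure_on oO Cphi; have Cr := C_closure_on oO Crho.
  apply/JpshP; split; first exact: C_closure_on.
  move=> p Op i pi Y YT.
  have [_ /(_ p Op i pi Y YT)] := (JpshP H Omega _).1 (He e e_gt0 e_lt).
  rewrite (leviD H Y oO Op pi Cr (C_onZ e oO Co)) (leviZ H Y oO Op pi e Co).
  rewrite (leviD H Y oO Op pi Co (C_onZ _ oO Cr)) (leviZ H Y oO Op pi _ Cr) => ge0.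
  have -> : levi H i phi p Y =
      real_complex R e^-1 * (real_complex R e * levi H i phi p Y).
    by rewrite mulrA -rmorphM mulVf ?gt_eqF // rmorph1 mul1r.
  by rewrite -mulrDr mulr_ge0 ?ler0c ?invr_ge0 ?(ltW e_gt0) // addrC.
have [|s0 s00 us] := sub _ Cp Jp.
  by move=> p bp; rewrite rho0 // mulr0 addr0.
by exists (fun p => phi p + e^-1 * rho p + s0 * (expR (rho p) - 1)); exact: us.
Qed.
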